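(* Let $n\ge1$ and let $(M,\nabla,P)$ be an infinitesimally homogeneous affine manifold with structure group $G=\operatorname{U}(n)\times\{1\}$, $T_0=0$, and inner torsion parameters $(a,b,\alpha,\beta,\gamma,\delta)$. Then $\nabla$ is the Levi-Civita connection of $g=h+\eta\otimes\eta$ if and only if $$a=b=0,\qquad\gamma=-\alpha,\qquad\delta=-\beta.$$ In this case, $$\nabla_X\xi=\alpha X+\beta JX,\qquad X\in H,$$ and the associated almost contact metric structure $(\phi,\xi,\eta,g)$ is trans-Sasakian of type $(\alpha_T,\beta_T)=(-\beta,\alpha)$. Moreover, $\alpha_T\beta_T=0$.
   Context: Let $V$ be a finite-dimensional real vector space and $G\subseteq\operatorname{GL}(V)$ a Lie subgroup with Lie algebra $\mathfrak g\subseteq\mathfrak{gl}(V)$. A $G$-structure on a smooth manifold $M$ with $\dim M=\dim V$ is a principal $G$-subbundle $P$ of the frame bundle $\operatorname{FR}(TM)$; elements $p\in P_x$ are linear isomorphisms $p:V\to T_xM$, and two frames in $P_x$ differ by right composition with an element of $G$. An affine manifold with $G$-structure is a triple $(M,\nabla,P)$ with $\nabla$ an affine connection on $M$ and $P$ a $G$-structure. Put $T(X,Y)=\nabla_XY-\nabla_YX-[X,Y]$ and $R(X,Y)=\nabla_X\nabla_Y-\nabla_Y\nabla_X-\nabla_{[X,Y]}$. Inner torsion: for a local section $s:U\to P$ define $\Lambda^s_x(u)\in\mathfrak{gl}(V)$ by $\nabla_{s(x)u}(s\,w)=s(x)(\Lambda^s_x(u)w)$ for $u,w\in V$, where $s\,w$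 is the vector field $x\mapsto s(x)w$. With $\mathfrak g_x=\operatorname{Ad}_p(\mathfrak g)$ for any $p\in P_x$ and $\overline{\operatorname{Ad}}_p:\mathfrak{gl}(V)/\mathfrak g\to\mathfrak{gl}(T_xM)/\mathfrak g_x$ induced by conjugation by $p$, the inner torsion is $\mathfrak I^P_x:T_xM\to\mathfrak{gl}(T_xM)/\mathfrak g_x$, $\mathfrak I^P_x(s(x)u)=\overline{\operatorname{Ad}}_{s(x)}(\Lambda^s_x(u)+\mathfrak g)$ (independent of $s$). $(M,\nabla,P)$ is infinitesimally homogeneous if there are linear maps $T_0:\Lambda^2V\to V$, $R_0:\Lambda^2V\to\mathfrak{gl}(V)$, $\mathfrak I_0:V\to\mathfrak{gl}(V)/\mathfrak g$ (the characteristic tensors) with $T_x(pu,pv)=p\,T_0(u,v)$, $R_x(pu,pv)pw=p\,R_0(u,v)w$, $\mathfrak I^P_x(pu)=\overline{\operatorname{Ad}}_p(\mathfrak I_0(u))$ for all $x\in M$, $p\in P_x$, $u,v,w\in V$. Here $V=H_0\oplus\mathbb Re$, where $H_0\simeq\mathbb R^{2n}$ has its standard Euclidean metric $h_0$, standard complex structure $J_0$ and $\omega_0(X,Y)=h_0(J_0X,Y)$. $G=\operatorname{U}(n)\times\{1\}\subset\operatorname{GL}(V)$ acts on $H_0$ by the standard real representation of $\operatorname{U}(n)$ and fixes $e$; $\mathfrak g=\mathfrak u(n)\oplus\{0\}$. Write $Z^\flat=h_0(Z,\cdot)$; matrices are with respect to $V=H_0\oplus\mathbb Re$. Inner torsion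 parameters: the unique $a,b,\alpha,\beta,\gamma,\delta\in\mathbb R$ with $\mathfrak I_0(X+se)=\lambda(X+se)+\mathfrak g$, where $$\lambda(X+se)=\begin{pmatrix}as\,\operatorname{Id}_{H_0}&\alpha X+\beta J_0X\\(\gamma X+\delta J_0X)^\flat&bs\end{pmatrix},\quad X\in H_0,\ s\in\mathbb R.$$ Geometric data of the $G$-structure: $H\subset TM$ is the rank-$2n$ distribution $H_x=p(H_0)$ and $\xi_x=p(e)$, $p\in P_x$; $h,J$ on $H$ correspond to $h_0,J_0$ through frames in $P$; $\eta$ is the $1$-form with $\eta(\xi)=1$, $\eta|_H=0$; $g=h+\eta\otimes\eta$ is the Riemannian metric extending $h$ for which $\xi$ is a unit field orthogonal to $H$; $\phi:TM\to TM$ is $\phi|_H=J$, $\phi(\xi)=0$. Then $(\phi,\xi,\eta,g)$ is an almost contact metric structure. It is trans-Sasakian of type $(\alpha_T,\beta_T)$ if, for the Levi-Civita connection $\nabla$ of $g$, $$(\nabla_X\phi)Y=\alpha_T\bigl(g(X,Y)\xi-\eta(Y)X\bigr)+\beta_T\bigl(g(\phi X,Y)\xi-\eta(Y)\phi X\bigr).$$ *)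

(* Defs.v *)
From HB Require Import structures.
From mathcomp Require Import all_boot all_order all_algebra.
From mathcomp Require Import complex.
From mathcomp Require Import all_classical all_reals all_analysis.

Set Implicit Arguments.
Unset Strict Implicit.
Unset Printing Implicit Defensive.

Import Order.TTheory GRing.Theory Num.Theory.
Import numFieldNormedType.Exports.
Local Open Scope classical_set_scope.
Local Open Scope ring_scope.

Section Cinf.
Context {R : realType} {E F : normedModType R}.

Definition iterD (vs : seq E) (f : E -> F) : E -> F :=
  foldr (fun v h => 'D_v h) f vs.

Definition Cinf_at (z : E) (f : E -> F) : Prop :=
  \forall y \near z, forall vs : seq E, differentiable (iterD vs f) y.

End Cinf.

(* [fwd] and [bwd] are total functions; only their restrictions to [dom] and
   [cod], which are mutually inverse homeomorphisms, are meaningful. *)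
Record chart (R : realType) (d : nat) (M : topologicalType) := Chart {
  dom : set M;
  cod : set 'cV[R]_d;
  fwd : M -> 'cV[R]_d;
  bwd : 'cV[R]_d -> M;
  dom_open : open dom;
  cod_open : open cod;
  fwd_cod : forall x, dom x -> cod (fwd x);
  bwd_dom : forall z, cod z -> dom (bwd z);
  fwdK : forall x, dom x -> bwd (fwd x) = x;
  bwdK : forall z, cod z -> fwd (bwd z) = z;
  fwd_continuous : {within dom, continuous fwd};
  bwd_continuous : {within cod, continuous bwd} }.

Record manifold (R : realType) (d : nat) := Manifold {
  carrier :> topologicalType;
  atlas : set (chart R d carrier);
  manifold_nonempty : [set: carrier] !=set0;
  manifold_hausdorff : hausdorff_space carrier;
  manifold_second_countable : @second_countable carrier;
  atlas_cover : forall x, exists2 c, atlas c & dom c x;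
  atlas_smooth : forall c c' x, atlas c -> atlas c' -> dom c x -> dom c' x ->
    Cinf_at (fwd c x) (fwd c' \o bwd c) }.

Section Tangent.
Context {R : realType} {d : nat} {M : manifold R d}.

Definition smooth_at (x : M) (f : M -> R) : Prop :=
  forall c, atlas c -> dom c x -> Cinf_at (fwd c x) (f \o bwd c).

(* Tangent vectors at [x] are the directional derivatives
   f |-> D_w (f o c^-1) (c x), in charts c around x, of the functions smooth
   near [x]; they are given the value 0 on all other functions, so that
   equality of tangent vectors is equality of functionals. *)
Definition is_tangent (x : M) (v : (M -> R) -> R^o) : Prop :=
  (forall f, ~ smooth_at x f -> v f = 0) /\
  forall c, atlas c -> dom c x -> exists w : 'cV[R]_d,
    forall f, smooth_at x f -> v f = 'D_w (f \o bwd c) (fwd c x).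

Definition tangent_pred (x : M) : {pred (M -> R) -> R^o} :=
  fun v => `[< is_tangent x v >].

End Tangent.

Section TangentSpace.
Context {R : realType} {d : nat} {M : manifold R d}.
Variable x : M.

Let smooth_differentiable (f : M -> R) (c : chart R d M) :
  smooth_at x f -> atlas c -> dom c x ->
  differentiable (f \o bwd c : 'cV[R]_d -> R^o) (fwd c x).
Proof. by move=> sf ac cx; have /nbhs_singleton/(_ [::]) := sf c ac cx. Qed.

Lemma tangent_submod_closed : submod_closed (tangent_pred x).
Proof.
split=> [|a u v /asboolP[u0 uc] /asboolP[v0 vc]]; apply/asboolP.
  split=> // c ac cx; exists 0 => f sf.
  have df := smooth_differentiable sf ac cx.
  by rewrite deriveE// linear0.
split=> [f nf|c ac cx].
  by rewrite /GRing.add/GRing.scale/= u0// v0// scaler0 addr0.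
have [w1 h1] := uc c ac cx; have [w2 h2] := vc c ac cx.
exists (a *: w1 + w2) => f sf.
have df := smooth_differentiable sf ac cx.
by rewrite !fctE h1// h2// !deriveE// linearP.
Qed.

HB.instance Definition _ :=
  GRing.isSubmodClosed.Build R ((M -> R) -> R^o) (tangent_pred x)
    tangent_submod_closed.

Record tangent_space := TangentVector {
  tv_fun :> (M -> R) -> R^o;
  tv_proof : tv_fun \in tangent_pred x }.

HB.instance Definition _ := [isSub for tv_fun].
HB.instance Definition _ := [Choice of tangent_space by <:].
HB.instance Definition _ := [SubChoice_isSubLmodule of tangent_space by <:].

End TangentSpace.

Section Connections.
Context {R : realType} {d : nat} {M : manifold R d}.

Definition vfield := forall x : M, tangent_space x.

(* The field is smooth on a neighbourhood of [x]: applying the condition to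
   chart coordinates gives smooth components near [x]. *)
Definition vfield_smooth_at (x : M) (X : vfield) : Prop :=
  forall f, smooth_at x f -> smooth_at x (fun y => X y f).

(* The Lie bracket is the tangent vector f |-> X (Y f) - Y (X f) at [x]; it
   exists and is unique when [X] and [Y] are smooth near [x]. *)
Definition bracket (X Y : vfield) : vfield := fun x =>
  xget 0 [set z : tangent_space x | forall f, smooth_at x f ->
    z f = X x (fun y => Y y f) - Y x (fun y => X y f)].

(* A connection acts on local fields: [nabla x v Y] is the covariant derivative
   at [x] of a field [Y] smooth near [x]; the other values are irrelevant. *)
Record connection := Connection {
  nabla :> forall x : M, tangent_space x -> vfield -> tangent_space x;
  nabla_linear : forall x Y, vfield_smooth_at x Y ->
    linear (fun v => nabla v Y : tangent_space x);
  nabla_additive : forall x (v : tangent_space x) Y Z,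
    vfield_smooth_at x Y -> vfield_smooth_at x Z ->
    nabla v (fun y => Y y + Z y) = nabla v Y + nabla v Z;
  nabla_leibniz : forall x (v : tangent_space x) (f : M -> R) Y,
    smooth_at x f -> vfield_smooth_at x Y ->
    nabla v (fun y => f y *: Y y) = v f *: Y x + f x *: nabla v Y;
  nabla_local : forall x (v : tangent_space x) Y Z,
    vfield_smooth_at x Y -> (\forall y \near x, Y y = Z y) ->
    nabla v Y = nabla v Z;
  nabla_smooth : forall x X Y,
    vfield_smooth_at x X -> vfield_smooth_at x Y ->
    vfield_smooth_at x (fun y => nabla (X y) Y) }.

Definition torsion (D : connection) (X Y : vfield) : vfield := fun x =>
  D x (X x) Y - D x (Y x) X - bracket X Y x.

Definition curvature (D : connection) (X Y Z : vfield) : vfield := fun x =>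
  D x (X x) (fun y => D y (Y y) Z) - D x (Y x) (fun y => D y (X y) Z)
  - D x (bracket X Y x) Z.

Definition two_tensor := forall x : M, tangent_space x -> tangent_space x -> R.

Definition riemannian_metric (g : two_tensor) : Prop :=
  [/\ forall x Y Z, vfield_smooth_at x Y -> vfield_smooth_at x Z ->
        smooth_at x (fun y => g y (Y y) (Z y)),
      forall x (w : tangent_space x) a u v,
        g x (a *: u + v) w = a * g x u w + g x v w,
      forall x (v w : tangent_space x), g x v w = g x w v &
      forall x (v : tangent_space x), v != 0 -> 0 < g x v v].

Definition is_levi_civita (D : connection) (g : two_tensor) : Prop :=
  (forall x X Y, vfield_smooth_at x X -> vfield_smooth_at x Y ->
    torsion D X Y x = 0) /\
  (forall x (v : tangent_space x) Y Z,
    vfield_smooth_at x Y -> vfield_smooth_at x Z ->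
    v (fun y => g y (Y y) (Z y)) = g x (D x v Y) (Z x) + g x (Y x) (D x v Z)).

End Connections.

Arguments vfield {R d} M.
Arguments connection {R d} M.
Arguments two_tensor {R d} M.

(* V is 'cV[R]_d and gl(V) is 'M[R]_d, acting on the left. *)

Section GStructures.
Context {R : realType} {d : nat} {M : manifold R d}.
Local Notation V := 'cV[R]_d.

Definition is_frame (x : M) (p : V -> tangent_space x) : Prop :=
  linear p /\ bijective p.

Definition frames := forall x : M, set (V -> tangent_space x).

(* The germ at [x] of a smooth local section of [P]. *)
Definition local_section (P : frames) (x : M)
    (s : forall y : M, V -> tangent_space y) : Prop :=
  (\forall y \near x, P y (s y)) /\
  forall w, vfield_smooth_at x (fun y => s y w).

Record is_Gstructure (G : set 'M[R]_d) (P : frames) : Prop := IsGstructure {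
  Gs_frame : forall x p, P x p -> is_frame p;
  Gs_act : forall x p A, P x p -> G A -> P x (fun u => p (A *m u));
  Gs_transitive : forall x p q, P x p -> P x q ->
    exists2 A, G A & q = (fun u => p (A *m u));
  Gs_section : forall x, exists s, local_section P x s }.

Variables (gg : set 'M[R]_d) (D : connection M) (P : frames).
Arguments P : clear implicits.

(* Elements of gl(V)/gg and of gl(T_xM)/gg_x are represented by cosets, that
   is, by sets of matrices and by sets of linear endomorphisms. *)
Definition coset (A : 'M[R]_d) : set 'M[R]_d := [set B | gg (B - A)].

Definition Adbar (x : M) (p : V -> tangent_space x) (C : set 'M[R]_d) :
    set (tangent_space x -> tangent_space x) :=
  [set B | linear B /\ exists2 A, C A & forall u, B (p u) = p (A *m u)].

(* [L] is the matrix Lambda^s_x(u). *)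
Definition is_Lambda (s : forall y : M, V -> tangent_space y) (x : M) (u : V)
    (L : 'M[R]_d) : Prop :=
  forall w, D x (s x u) (fun y => s y w) = s x (L *m w).

(* The union of the cosets Adbar_{s(x)}(Lambda^s_x(u) + gg) over all local
   sections s around [x], with s(x)u = v; these cosets are all equal. *)
Definition inner_torsion (x : M) (v : tangent_space x) :
    set (tangent_space x -> tangent_space x) :=
  [set B | exists s u L, [/\ local_section P x s, s x u = v,
    is_Lambda s x u L & Adbar (s x) (coset L) B]].

Definition alternating_bilinear (W : lmodType R) (B : V -> V -> W) : Prop :=
  [/\ forall w, linear (B^~ w), forall u, linear (B u) & forall u, B u u = 0].

(* [I0], with values in the cosets of [gg], is linear into gl(V)/gg. *)
Definition linear_mod (I0 : V -> set 'M[R]_d) : Prop :=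
  (forall u, exists A, I0 u = coset A) /\
  forall (c : R) u v A B, I0 u = coset A -> I0 v = coset B ->
    I0 (c *: u + v) = coset (c *: A + B).

(* The tensors T_x and R_x are evaluated on local smooth fields extending the
   given tangent vectors. *)
Record characteristic_tensors (T0 : V -> V -> V) (R0 : V -> V -> 'M[R]_d)
    (I0 : V -> set 'M[R]_d) : Prop := CharacteristicTensors {
  T0_alternating : alternating_bilinear T0;
  R0_alternating : alternating_bilinear R0;
  I0_linear : linear_mod I0;
  T0_torsion : forall x p u v X Y, P x p ->
    vfield_smooth_at x X -> vfield_smooth_at x Y ->
    X x = p u -> Y x = p v -> torsion D X Y x = p (T0 u v);
  R0_curvature : forall x p u v w X Y Z, P x p ->
    vfield_smooth_at x X -> vfield_smooth_at x Y -> vfield_smooth_at x Z ->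
    X x = p u -> Y x = p v -> Z x = p w ->
    curvature D X Y Z x = p (R0 u v *m w);
  I0_inner_torsion : forall x p u, P x p ->
    inner_torsion (p u) = Adbar p (I0 u) }.

End GStructures.

Arguments frames {R d} M.

(* An affine manifold with G-structure is infinitesimally homogeneous when it
   has characteristic tensors; [gg] is the Lie algebra of [G]. *)
Definition infinitesimally_homogeneous (R : realType) (d : nat)
    (M : manifold R d) (G gg : set 'M[R]_d) (D : connection M) (P : frames M)
    (T0 : 'cV[R]_d -> 'cV[R]_d -> 'cV[R]_d)
    (R0 : 'cV[R]_d -> 'cV[R]_d -> 'M[R]_d)
    (I0 : 'cV[R]_d -> set 'M[R]_d) : Prop :=
  is_Gstructure G P /\ characteristic_tensors gg D P T0 R0 I0.

(* G = U(n) x {1}: H0 is 'cV[R]_(n + n), with C^n identified with H0 by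
   x + iy |-> (x, y), and V is 'cV[R]_(n + n + 1). *)

Section Unitary.
Context {R : realType} {n : nat}.

Definition h0 (X Y : 'cV[R]_(n + n)) : R := (X^T *m Y) 0 0.

Definition J0 : 'M[R]_(n + n) := block_mx 0 (- 1%:M) 1%:M 0.

Definition realify (U : 'M[R[i]]_n) : 'M[R]_(n + n) :=
  block_mx (map_mx (@complex.Re R) U) (- map_mx (@complex.Im R) U)
           (map_mx (@complex.Im R) U) (map_mx (@complex.Re R) U).

Definition Un1 : set 'M[R]_(n + n + 1) :=
  [set A | exists2 U, U \is unitarymx & A = block_mx (realify U) 0 0 1%:M].

(* The Lie algebra u(n) (+) {0}, u(n) being the skew-Hermitian matrices. *)
Definition un0 : set 'M[R]_(n + n + 1) :=
  [set A | exists2 U : 'M[R[i]]_n, (U ^t* )%sesqui = - U &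
           A = block_mx (realify U) 0 0 0].

Definition H0vec (X : 'cV[R]_(n + n)) : 'cV[R]_(n + n + 1) := col_mx X 0.

Definition evec : 'cV[R]_(n + n + 1) := col_mx 0 1%:M.

Definition lambda (a b al be ga de : R) (X : 'cV[R]_(n + n)) (s : R) :
    'M[R]_(n + n + 1) :=
  block_mx (a * s)%:M (al *: X + be *: (J0 *m X))
           (ga *: X + de *: (J0 *m X))^T (b * s)%:M.

Definition inner_torsion_parameters (I0 : 'cV[R]_(n + n + 1) ->
    set 'M[R]_(n + n + 1)) (a b al be ga de : R) : Prop :=
  forall X s, I0 (col_mx X s%:M) = coset un0 (lambda a b al be ga de X s).

(* Geometric data of the structure. They are read in a chosen frame at each
   point, and do not depend on the choice, as U(n) x {1} preserves h0, J0 and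
   the decomposition of V, and fixes e. *)
Variables (M : manifold R (n + n + 1)) (P : frames M).
Arguments P : clear implicits.

Definition frame_at (x : M) : 'cV[R]_(n + n + 1) -> tangent_space x :=
  xget (fun=> 0) (P x).

Definition coord (x : M) (v : tangent_space x) : 'cV[R]_(n + n + 1) :=
  xget 0 [set u | frame_at x u = v].

Definition Hdist (x : M) : set (tangent_space x) :=
  [set v | exists X, v = frame_at x (H0vec X)].

Definition xi : vfield M := fun x => frame_at x evec.

Definition eta (x : M) (v : tangent_space x) : R := dsubmx (coord v) 0 0.

(* The metric of [Hdist], extended by 0 along [xi]. *)
Definition hmetric : two_tensor M := fun x v w =>
  h0 (usubmx (coord v)) (usubmx (coord w)).

Definition gmetric : two_tensor M := fun x v w =>
  hmetric v w + eta v * eta w.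

Definition phi (x : M) (v : tangent_space x) : tangent_space x :=
  frame_at x (H0vec (J0 *m usubmx (coord v))).

End Unitary.

Section TransSasakian.
Context {R : realType} {d : nat} {M : manifold R d}.
Variables (phi : forall x : M, tangent_space x -> tangent_space x)
  (xi : vfield M) (eta : forall x : M, tangent_space x -> R) (g : two_tensor M).
Arguments g : clear implicits.

Record almost_contact_metric : Prop := AlmostContactMetric {
  acm_phi_linear : forall x, linear (@phi x);
  acm_eta_linear : forall x, linear (@eta x : tangent_space x -> R^o);
  acm_phi_smooth : forall x X, vfield_smooth_at x X ->
    vfield_smooth_at x (fun y => phi (X y));
  acm_eta_smooth : forall x X, vfield_smooth_at x X ->
    smooth_at x (fun y => eta (X y));
  acm_xi_smooth : forall x, vfield_smooth_at x xi;
  acm_riemannian : riemannian_metric g;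
  acm_phi2 : forall x (v : tangent_space x),
    phi (phi v) = - v + eta v *: xi x;
  acm_eta_xi : forall x, eta (xi x) = 1;
  acm_compatible : forall x (v w : tangent_space x),
    g x (phi v) (phi w) = g x v w - eta v * eta w }.

(* The connection [D] below is the Levi-Civita connection of [g]. *)
Definition trans_sasakian (aT bT : R) : Prop :=
  almost_contact_metric /\
  exists2 D : connection M, is_levi_civita D g &
    forall x (v : tangent_space x) Y, vfield_smooth_at x Y ->
      D x v (fun y => phi (Y y)) - phi (D x v Y) =
      aT *: (g x v (Y x) *: xi x - eta (Y x) *: v) +
      bT *: (g x (phi v) (Y x) *: xi x - eta (Y x) *: phi v).

End TransSasakian.

(* Main.v *)
From HB Require Import structures.
Require Import Defs.
From mathcomp Require Import all_boot all_order all_algebra.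
From mathcomp Require Import all_classical all_reals all_analysis.
From mathcomp Require Import complex ring lra.
Import Order.TTheory GRing.Theory Num.Theory.
Import numFieldNormedType.Exports.
Local Open Scope classical_set_scope.
Local Open Scope ring_scope.

(** Let s be a local section of P and L(u) the matrix of the covariant
    derivative along s u on the frame fields s w. Homogeneity determines L(u)
    modulo u(n): L(u) = lambda(u) + A(u), where A(u) is skew, commutes with the
    structure endomorphism Phi0 (J0 on H0 and 0 on e) and kills e
    ([Lambda_un0], [un0P]). Hence every assertion about e, Phi0 and the
    Euclidean product that only involves L(u) up to such an A(u) is an
    assertion about lambda(u).

    As T0 = 0, the connection is torsion free, and it is the Levi-Civita
    connection exactly when it is metric. The frames of P are orthonormal for
    g, and the components of a smooth field in a smooth frame are smooth
    ([smooth_components]); so, by the Leibniz rule in a frame ([nabla_frame]),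
    being metric means that all L(u), that is all lambda(u), are skew.
    Evaluating the skewness of lambda on e, on a horizontal h and on Phi0 h
    gives the four equations on the parameters ([levi_civita_params],
    [metric_is_levi_civita]). In this case the covariant derivative of xi along
    s u is s (lambda(u) e), and the covariant derivative of phi is the
    commutator of lambda(u) with Phi0; reading them off yields the formula for
    xi ([nabla_xi]) and the trans-Sasakian identity ([metric_trans_sasakian]).

    For alpha beta = 0, write zeta(u) = lambda(u) e. The eta-component of the
    bracket of the frame fields s u and s v is the constant
    - 2 beta <Phi0 u, v>, and the component of the bracket in general is
    L(u) v - L(v) u. Taking the eta-component of the Jacobi identity for s e,
    s h and s (Phi0 h) then gives 4 alpha beta |h|^2 = 0 ([product_zero]); in
    other words, d (d eta) = 0 while d eta is a multiple of beta whose own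
    differential is a multiple of alpha.

    The Jacobi identity rests on the fact that brackets act on functions as
    commutators ([bracketE]), which in turn needs the symmetry of second
    derivatives ([derive_sym]) and the stability of smooth functions under
    products, quotients and composition. *)

Set Implicit Arguments.
Unset Strict Implicit.
Unset Printing Implicit Defensive.

(** * Smooth functions on normed spaces *)

Section Locality.
Context {R : realType} {E F : normedModType R}.

Lemma near_eq_differentiable (f g : E -> F) (x : E) :
  {near x, f =1 g} -> differentiable f x -> differentiable g x.
Proof.
move=> fg df; have [dfc fE] := (diff_locallyP _ _).1 df.
have gE : g \o shift x = cst (g x) + 'd f x +o_ 0 id.
  apply/eqaddoP => e e0.
  move/eqaddoP : fE => /(_ e e0) fe.
  have fg0 : \forall h \near (0 : E), f (h + x) = g (h + x).
    by move: (fg); rewrite {1}(near_shift 0) /= subr0.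
  near=> h.
  have -> : (g \o shift x - (cst (g x) + 'd f x)) h =
            (f \o shift x - (cst (f x) + 'd f x)) h.
    rewrite !fctE /= -(nbhs_singleton fg); congr (_ - _).
    by rewrite (near fg0 h).
  by near: h.
have dE := diff_unique dfc gE.
by apply/diff_locallyP; rewrite dE.
Unshelve. all: by end_near. Qed.

Lemma iterD_rcons (vs : seq E) v (f : E -> F) :
  Defs.iterD (rcons vs v) f = Defs.iterD vs ('D_v f).
Proof. by rewrite /Defs.iterD foldr_rcons. Qed.

Lemma iterD_eq (U : set E) (vs : seq E) (f g : E -> F) : open U ->
  (forall y, U y -> f y = g y) -> forall y, U y ->
    Defs.iterD vs f y = Defs.iterD vs g y.
Proof.
move=> oU fg; elim: vs => [|v vs IH] y Uy; first exact: fg.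
rewrite /= ; apply: near_eq_derive.
near=> z; apply: IH; near: z; exact: open_nbhs_nbhs.
Unshelve. all: by end_near. Qed.

(** The finite order is what makes induction possible for reciprocals and
    composites: their derivatives involve the function under study again, of
    which one order of smoothness is already known. *)
Definition Cn (n : nat) (U : set E) (f : E -> F) :=
  forall vs : seq E, (size vs <= n)%N -> forall y, U y ->
    differentiable (Defs.iterD vs f) y.

Lemma Cn_le m n U f : (m <= n)%N -> Cn n U f -> Cn m U f.
Proof. by move=> mn fn vs /leq_trans/(_ mn)/fn. Qed.

Lemma Cn_sub n U V f : V `<=` U -> Cn n U f -> Cn n V f.
Proof. by move=> VU fn vs s y /VU; exact: fn. Qed.

Lemma Cn_diff n U f y : Cn n U f -> U y -> differentiable f y.
Proof. by move=> fn; exact: (fn [::] isT y). Qed.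

Lemma CnS n U f : Cn n.+1 U f <->
  (forall y, U y -> differentiable f y) /\ forall v, Cn n U ('D_v f).
Proof.
split=> [fn|[f0 fn]].
  by split=> [y|v vs svs y]; [exact: Cn_diff fn|
    rewrite -iterD_rcons; apply: fn; rewrite size_rcons].
move=> vs; case/lastP: vs => [|vs v]; first by move=> _; exact: f0.
by rewrite size_rcons ltnS iterD_rcons; exact: fn.
Qed.

Lemma Cn0 U f : (forall y, U y -> differentiable f y) -> Cn 0 U f.
Proof. by move=> df [|//] _ y /df. Qed.

Lemma Cn_ext n U f g : open U -> (forall y, U y -> f y = g y) ->
  Cn n U f -> Cn n U g.
Proof.
move=> oU fg fn vs svs y Uy; apply: near_eq_differentiable (fn vs svs y Uy).
near=> z; apply: (iterD_eq _ oU fg); near: z; exact: open_nbhs_nbhs.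
Unshelve. all: by end_near. Qed.

Lemma Cn_cst n U (a : F) : Cn n U (cst a).
Proof.
elim: n a => [|n IH] a; first by apply: Cn0.
apply/CnS; split=> [y _|v]; first exact: differentiable_cst.
by rewrite (_ : 'D_v _ = cst 0) //; apply/funext=> y; rewrite derive_cst.
Qed.

Lemma CnD n U (f g : E -> F) : open U -> Cn n U f -> Cn n U g ->
  Cn n U (f + g).
Proof.
move=> oU; elim: n f g => [|n IH] f g fn gn.
  by apply: Cn0 => y Uy; apply: differentiableD;
    [exact: Cn_diff fn Uy|exact: Cn_diff gn Uy].
have [df fD] := (CnS _ _ _).1 fn; have [dg gD] := (CnS _ _ _).1 gn.
apply/CnS; split=> [y Uy|v]; first by apply: differentiableD;
  [exact: df|exact: dg].
apply: (Cn_ext (f := 'D_v f + 'D_v g)) => //; last exact: IH.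
by move=> y Uy; rewrite deriveD//; apply: diff_derivable; [exact: df|exact: dg].
Qed.

End Locality.

Section Closure.
Context {R : realType} {E : normedModType R}.
Implicit Types f g : E -> R^o.

Lemma CnM n U f g : open U -> Cn n U f -> Cn n U g -> Cn n U (f * g : E -> R^o).
Proof.
move=> oU; elim: n f g => [|n IH] f g fn gn.
  by apply: Cn0 => y Uy; apply: (@differentiableM R);
    [exact: Cn_diff fn Uy|exact: Cn_diff gn Uy].
have [df fD] := (CnS _ _ _).1 fn; have [dg gD] := (CnS _ _ _).1 gn.
apply/CnS; split=> [y Uy|v].
  by apply: (@differentiableM R); [exact: df|exact: dg].
apply: (Cn_ext (f := (f * 'D_v g : E -> R^o) + (g * 'D_v f : E -> R^o))) => //.
  by move=> y Uy; rewrite deriveM//; apply: diff_derivable;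
    [exact: df|exact: dg].
by apply: CnD => //; apply: IH => //; [exact: Cn_le fn|exact: Cn_le gn].
Qed.

Lemma CnN n U f : open U -> Cn n U f -> Cn n U (- f : E -> R^o).
Proof.
move=> oU fn.
apply: (Cn_ext (f := (cst (- 1) : E -> R^o) * f : E -> R^o)) => //.
  by move=> y _; rewrite !fctE mulN1r.
by apply: CnM => //; exact: Cn_cst.
Qed.

Lemma CnV n U f : open U -> (forall y, U y -> f y != 0) -> Cn n U f ->
  Cn n U (fun y => (f y)^-1 : R^o).
Proof.
move=> oU f0; elim: n f f0 => [|n IH] f f0 fn.
  by apply: Cn0 => y Uy; apply: (@differentiableV R);
    [exact: Cn_diff fn Uy|exact: f0].
have [df fD] := (CnS _ _ _).1 fn.
have vn : Cn n U (fun y => (f y)^-1 : R^o) by apply: IH => //; exact: Cn_le fn.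
apply/CnS; split=> [y Uy|v]; first by apply: (@differentiableV R);
  [exact: df|exact: f0].
apply: (Cn_ext (f := - ((fun y => (f y)^-1 : R^o) * (fun y => (f y)^-1 : R^o) *
                        'D_v f) : E -> R^o)) => //.
  move=> y Uy; rewrite deriveV; [|exact: f0|exact/diff_derivable/df].
  by rewrite !fctE /GRing.scale /= -exprVn expr2 mulNr.
by apply: CnN => //; do 2?apply: CnM.
Qed.

Lemma Cn_sum n U m (f : 'I_m -> E -> R^o) : open U ->
  (forall i, Cn n U (f i)) -> Cn n U (fun y => \sum_i f i y).
Proof.
move=> oU; elim: m f => [|m IH] f fn.
  apply: (Cn_ext (f := cst 0)) => //; last exact: Cn_cst.
  by move=> y _; rewrite big_ord0.
apply: (Cn_ext (f := f ord0 + (fun y => \sum_i f (lift ord0 i) y))) => //.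
  by move=> y _; rewrite big_ord_recl.
by apply: CnD => //; exact: IH.
Qed.

Lemma Cn_coord n U d (f : E -> 'cV[R]_d) j : open U ->
  Cn n U f -> Cn n U (fun y => f y j 0 : R^o).
Proof.
move=> oU; elim: n f => [|n IH] f fn.
  apply: Cn0 => y Uy; apply: (differentiable_comp (g := fun N : 'cV[R]_d =>
    N j 0 : R^o)).
    exact: Cn_diff fn Uy.
  exact: differentiable_coord.
have [df fD] := (CnS _ _ _).1 fn; apply/CnS; split=> [y Uy|v].
  apply: (differentiable_comp (g := fun N : 'cV[R]_d => N j 0 : R^o));
    first exact: df.
  exact: differentiable_coord.
apply: (Cn_ext (f := fun y => ('D_v f y) j 0 : R^o)) => //; last exact: IH.
by move=> y Uy; rewrite derive_mx ?mxE//; exact/diff_derivable/df.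
Qed.

Lemma diff_cV d (f : 'cV[R]_d -> R^o) x w : differentiable f x ->
  'd f x w = \sum_j w j 0 * 'D_(delta_mx j 0) f x.
Proof.
move=> df; have {1}-> : w = \sum_j w j 0 *: delta_mx j 0.
  rewrite {1}[w]matrix_sum_delta; apply: eq_bigr => i _.
  by rewrite big_ord1.
rewrite linear_sum; apply: eq_bigr => j _.
by rewrite linearZ deriveE.
Qed.

Lemma derive_cV d (f : 'cV[R]_d -> R^o) x w : differentiable f x ->
  'D_w f x = \sum_j w j 0 * 'D_(delta_mx j 0) f x.
Proof. by move=> df; rewrite deriveE// diff_cV. Qed.

(** By the chain rule the derivative of f o h along v is the sum over j of
    (D_j f o h) D_v h_j, where D_j f o h is a composite of lower order. *)
Lemma Cn_comp n U d (W : set 'cV[R]_d) (f : 'cV[R]_d -> R^o)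
    (h : E -> 'cV[R]_d) :
  open U -> open W -> (forall y, U y -> W (h y)) ->
  Cn n W f -> Cn n U h -> Cn n U (f \o h).
Proof.
move=> oU oW hUW; elim: n f => [|n IH] f fn hn.
  by apply: Cn0 => y Uy; apply: differentiable_comp;
    [exact: Cn_diff hn Uy|exact: Cn_diff fn (hUW _ Uy)].
have [df fD] := (CnS _ _ _).1 fn; have [dh hD] := (CnS _ _ _).1 hn.
apply/CnS; split=> [y Uy|v].
  by apply: differentiable_comp; [exact: dh|exact/df/hUW].
apply: (Cn_ext (f := fun y => \sum_j
   (((fun y => 'D_v h y j 0 : R^o) : E -> R^o) *
    ('D_(delta_mx j 0) f \o h) : E -> R^o) y)) => //.
  move=> y Uy; rewrite deriveE; last first.
    by apply: differentiable_comp; [exact: dh|exact/df/hUW].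
  have dhy := dh _ Uy; have dfy := df _ (hUW _ Uy).
  rewrite diff_comp //= diff_cV//; apply: eq_bigr => j _.
  by rewrite -(deriveE v dhy).
apply: Cn_sum => // j; apply: CnM => //; first exact: Cn_coord.
by apply: IH => //; exact: Cn_le hn.
Qed.

End Closure.

Section CinfGerms.
Context {R : realType} {E : normedModType R}.

Lemma Cinf_atP (F : normedModType R) (z : E) (f : E -> F) :
  Cinf_at z f <-> exists2 U, open_nbhs z U & forall n, Cn n U f.
Proof.
split=> [|[U oU fU]].
  rewrite /Cinf_at -nbhs_nearE nbhsE => -[U oU fU].
  by exists U => // n vs _ y /fU; exact.
by apply: filterS (open_nbhs_nbhs oU) => y Uy vs; exact: fU (leqnn _) _ Uy.
Qed.

Lemma Cinf_near (F : normedModType R) (z : E) (f : E -> F) :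
  Cinf_at z f -> \forall y \near z, Cinf_at y f.
Proof. exact: near_join. Qed.

Lemma Cinf_diff (F : normedModType R) (z : E) (f : E -> F) :
  Cinf_at z f -> differentiable f z.
Proof. by move=> /nbhs_singleton /(_ [::]). Qed.

Lemma Cinf_derivable (F : normedModType R) (z v : E) (f : E -> F) :
  Cinf_at z f -> derivable f z v.
Proof. by move=> /Cinf_diff /diff_derivable. Qed.

Lemma Cinf_cont (F : normedModType R) (z : E) (f : E -> F) :
  Cinf_at z f -> {for z, continuous f}.
Proof. by move=> /Cinf_diff /differentiable_continuous. Qed.

Lemma Cinf_eq (F : normedModType R) (z : E) (f g : E -> F) :
  {near z, f =1 g} -> Cinf_at z f -> Cinf_at z g.
Proof.
move=> fg /Cinf_atP[U [oU Uz] fU]; apply/Cinf_atP.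
move: fg; rewrite -nbhs_nearE nbhsE => -[V [oV Vz] fV].
have oUV : open (U `&` V) by exact: openI.
exists (U `&` V) => // n; apply: (Cn_ext (f := f)) => //.
  by move=> y [_ /fV].
by apply: Cn_sub (fU n) => y [].
Qed.

Lemma Cinf_cst (F : normedModType R) (z : E) (a : F) : Cinf_at z (cst a).
Proof.
apply/Cinf_atP; exists setT; first by split=> //; exact: openT.
by move=> n; exact: Cn_cst.
Qed.

Lemma Cinf_at2 (F G K : normedModType R) (z : E)
    (f : E -> F) (g : E -> G) (k : E -> K) :
  (forall U n, open U -> Cn n U f -> Cn n U g -> Cn n U k) ->
  Cinf_at z f -> Cinf_at z g -> Cinf_at z k.
Proof.
move=> fgk /Cinf_atP[U [oU Uz] fU] /Cinf_atP[V [oV Vz] gV]; apply/Cinf_atP.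
have oUV : open (U `&` V) by exact: openI.
exists (U `&` V) => // n; apply: fgk => //.
  by apply: Cn_sub (fU n) => y [].
by apply: Cn_sub (gV n) => y [].
Qed.

Lemma CinfD (z : E) (f g : E -> R^o) : Cinf_at z f -> Cinf_at z g ->
  Cinf_at z (f + g).
Proof. by apply: Cinf_at2 => U n; exact: CnD. Qed.

Lemma CinfM (z : E) (f g : E -> R^o) :
  Cinf_at z f -> Cinf_at z g -> Cinf_at z (f * g : E -> R^o).
Proof. by apply: Cinf_at2 => U n; exact: CnM. Qed.

Lemma CinfV (z : E) (f : E -> R^o) : f z != 0 ->
  Cinf_at z f -> Cinf_at z (fun y => (f y)^-1 : R^o).
Proof.
move=> f0 fz; have cf := Cinf_cont fz.
have : \forall y \near z, f y != 0 by exact: (cvgr_neq0 (f z)).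
rewrite -nbhs_nearE nbhsE => -[V [oV Vz] fV];
  move/Cinf_atP: fz => [U [oU Uz] fU].
apply/Cinf_atP; have oUV : open (U `&` V) by exact: openI.
exists (U `&` V) => // n; apply: CnV => // [y [_ /fV]//|].
by apply: Cn_sub (fU n) => y [].
Qed.

Lemma Cinf_derive (F : normedModType R) (z v : E) (f : E -> F) :
  Cinf_at z f -> Cinf_at z ('D_v f).
Proof.
move=> /Cinf_atP[U oU fU]; apply/Cinf_atP; exists U => // n.
by have [_] := (CnS _ _ _).1 (fU n.+1).
Qed.

Lemma Cinf_coord d (z : E) (f : E -> 'cV[R]_d) j :
  Cinf_at z f -> Cinf_at z (fun y => f y j 0 : R^o).
Proof.
move=> /Cinf_atP[U [oU Uz] fU]; apply/Cinf_atP; exists U => // n.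
exact: Cn_coord.
Qed.

End CinfGerms.

Lemma Cinf_comp (R : realType) (E : normedModType R) d (z : E)
    (f : 'cV[R]_d -> R^o) (h : E -> 'cV[R]_d) :
  Cinf_at z h -> Cinf_at (h z) f -> Cinf_at z (f \o h).
Proof.
move=> hz /Cinf_atP[W [oW Wz] fW]; have ch := Cinf_cont hz.
have : \forall y \near z, W (h y) by apply: (ch W); exact: open_nbhs_nbhs.
rewrite -nbhs_nearE nbhsE => -[V [oV Vz] hV];
  have /Cinf_atP[U [oU Uz] hU] := hz.
apply/Cinf_atP; have oUV : open (U `&` V) by exact: openI.
exists (U `&` V) => // n; apply: (@Cn_comp R E n _ d W) => //.
  by move=> y [_ /hV].
by apply: Cn_sub (hU n) => y [].
Qed.

Section Symmetry.
Context {R : realType} {E : normedModType R}.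
Implicit Types (f : E -> R^o) (x u v : E).

Lemma is_derive_line f (s : R) u y : differentiable f (s *: u + y) ->
  is_derive s (1 : R) (fun r : R => f (r *: u + y) : R^o) ('D_u f (s *: u + y)).
Proof.
move=> df; have dfu : derivable f (s *: u + y) u := diff_derivable df.
have lineE : (fun h : R =>
  h^-1 *: (f (h *: u + (s *: u + y)) - f (s *: u + y))) =
  (fun h => h^-1 *: (f ((h *: (1 : R) + s) *: u + y) - f (s *: u + y))).
  by apply/funext=> h; rewrite scalerDl addrA /GRing.scale /= mulr1.
apply: DeriveDef; first by rewrite /derivable -lineE.
by rewrite /derive -lineE.
Qed.

(** The second difference is the increment over [0, t] of
    s |-> f (s u + t v + x) - f (s u + x); the mean value theorem turns it into
    t times an increment of D_u f, estimated by the differential of D_u f. *)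
Lemma second_difference f x u v (e : R) :
  (\forall y \near x, differentiable f y) -> differentiable ('D_u f) x ->
    0 < e ->
  \forall t \near (0 : R), 0 < t ->
    `|f (t *: u + (t *: v + x)) - f (t *: u + x) - f (t *: v + x) + f x
      - t ^+ 2 * 'D_v ('D_u f) x| <= e * t ^+ 2.
Proof.
move=> df dG e0; set G := 'D_u f; set K := 2 * `|u| + `|v| + 1.
have K0 : 0 < K by rewrite ltr_wpDl// addr_ge0// mulr_ge0.
(* Near 0 the error of the first order expansion of D_u f is to be at most
   e / K * |h|; it is used below at c u + t v and at c u with 0 <= c <= t, and
   K bounds the sum of the norms of both, divided by t. *)
have [dGc GE] := (diff_locallyP _ _).1 dG.
have eK : 0 < e / K by rewrite divr_gt0.
move/eqaddoP : GE => /(_ _ eK) GE.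
have df0 : \forall h \near (0 : E), differentiable f (h + x).
  by move: df; rewrite {1}(near_shift 0) /= subr0.
have [r /= r0 rP] := (@nbhs_ballP R E (0 : E) _).1 (filterI GE df0).
near=> t => t0.
have tK : t * K < r.
  rewrite -ltr_pdivlMr//; apply: le_lt_trans (ler_norm t) _.
  near: t; apply: (@nbhs0_lt R R^o (r / K)).
  by rewrite divr_gt0.
have inr c w : 0 <= c -> c <= t -> `|w| <= t * `|v| -> ball 0 r (c *: u + w).
  move=> c0 ct wv; rewrite -ball_normE /= sub0r normrN.
  apply: le_lt_trans tK; apply: le_trans (ler_normD _ _) _.
  rewrite normrZ ger0_norm// /K !mulrDr -addrA lerD//; last first.
    by apply: le_trans wv _; rewrite lerDl mulr1 ltW.
  rewrite mulrA; apply: ler_pM => //.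
  by apply: le_trans ct _; rewrite ler_peMr ?(ltW t0)// ler1n.
have nv0 : `|0 : E| <= t * `|v| by rewrite normr0 mulr_ge0// ltW.
pose p (s : R) : R^o := f (s *: u + (t *: v + x)) - f (s *: u + x).
have dp s : 0 <= s -> s <= t ->
    is_derive s (1 : R) p (G (s *: u + (t *: v + x)) - G (s *: u + x)).
  move=> s0 st; apply: is_deriveB; apply: is_derive_line.
    have := inr s (t *: v) s0 st;
      rewrite normrZ gtr0_norm// => /(_ (lexx _)) /rP[_].
    by rewrite /= addrA.
  by have := inr s 0 s0 st nv0; rewrite addr0 => /rP[_].
have := @MVT R p (fun s => G (s *: u + (t *: v + x)) - G (s *: u + x)) 0 t t0.
case.
- by move=> s; rewrite in_itv /= => /andP[s0 st]; apply: dp; exact: ltW.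
- apply: derivable_within_continuous => s; rewrite in_itv /= => /andP[s0 st].
  by have [] := dp s s0 st.
move=> c; rewrite in_itv /= => /andP[/ltW c0 /ltW ct].
rewrite /p !scale0r !add0r subr0 => pE.
have -> : f (t *: u + (t *: v + x)) - f (t *: u + x) - f (t *: v + x) + f x =
  (G (c *: u + (t *: v + x)) - G (c *: u + x)) * t.
  by rewrite -pE; ring.
have tv : `|t *: v| <= t * `|v| by rewrite normrZ gtr0_norm.
pose a1 : R := 'D_u f (c *: u + x);
  pose a2 : R := 'D_u f (c *: u + (t *: v + x)).
pose g0 : R := 'D_u f x; pose D1 : R := 'd ('D_u f) x u;
  pose D2 : R := 'D_v ('D_u f) x.
have dlin1 : 'd ('D_u f) x (c *: u) = c * D1 by rewrite linearZ.
have dlin2 : 'd ('D_u f) x (c *: u + t *: v) = c * D1 + t * D2.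
  by rewrite linearD !linearZ -(deriveE v dG).
have A2 : `|a2 - (g0 + (c * D1 + t * D2))| <= e / K * `|c *: u + t *: v|.
  have [+ _] := rP _ (inr c (t *: v) c0 ct tv).
  by rewrite /= !fctE /= dlin2 -addrA.
have A1 : `|a1 - (g0 + c * D1)| <= e / K * `|c *: u|.
  have := inr c 0 c0 ct nv0; rewrite addr0 => /rP[+ _].
  by rewrite /= !fctE /= dlin1.
have B1 : `|c *: u| <= t * `|u| by rewrite normrZ ger0_norm// ler_wpM2r.
have B2 : `|c *: u + t *: v| <= t * `|u| + t * `|v|.
  by apply: le_trans (ler_normD _ _) _; exact: lerD.
suff : `|(a2 - a1) * t - t ^+ 2 * D2| <= e * t ^+ 2 by [].
have -> : (a2 - a1) * t - t ^+ 2 * D2 =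
  t * ((a2 - (g0 + (c * D1 + t * D2))) - (a1 - (g0 + c * D1))) by ring.
rewrite normrM gtr0_norm// expr2 mulrCA ler_pM2l//.
apply: le_trans (ler_normB _ _) _; apply: le_trans (lerD A2 A1) _.
rewrite -mulrDr -mulrA ler_pM2l// mulrC ler_pdivrMr//.
apply: le_trans (lerD B2 B1) _; rewrite /K.
have -> : t * (2 * `|u| + `|v| + 1) =
  t * `|u| + t * `|v| + t * `|u| + t by ring.
by rewrite lerDl ltW.
Unshelve. all: by end_near. Qed.

(** Both iterated derivatives are the limit of the same second difference
    divided by t ^ 2, as this difference is symmetric in u and v. *)
Lemma derive_sym f x u v : Cinf_at x f -> 'D_v ('D_u f) x = 'D_u ('D_v f) x.
Proof.
move=> fx; have df : \forall y \near x, differentiable f y.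
  by near do apply: Cinf_diff; exact: Cinf_near.
have du := Cinf_diff (Cinf_derive u fx);
  have dv := Cinf_diff (Cinf_derive v fx).
apply/eqP; rewrite -subr_eq0 -normr_le0; apply/ler_addgt0Pr => _/posnumP[e].
rewrite add0r.
have alg (p q r s a b k : R) :
  (p - q - r + s - k * b) - (p - r - q + s - k * a) = (a - b) * k by ring.
have e2 : 0 < e%:num / 2 by [].
have A1 := second_difference v df du e2;
  have A2 := second_difference u df dv e2.
have : \forall t \near (0 : R), 0 < t ->
  `|'D_v ('D_u f) x - 'D_u ('D_v f) x| <= e%:num.
  apply: filterS2 A1 A2 => t A1 A2 t0.
  have {}A1 := A1 t0; have {}A2 := A2 t0.
  have t2 : 0 < t ^+ 2 by rewrite exprn_gt0.
  rewrite -(ler_pM2r t2) [e%:num]splitr mulrDl -{1}(gtr0_norm t2) -normrM.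
  apply: le_trans (lerD A2 A1); apply: le_trans (ler_normB _ _).
  by rewrite [t *: v + (_ + _)]addrCA alg.
move=> near_t; have : \forall t \near (0 : R)^'+,
  `|'D_v ('D_u f) x - 'D_u ('D_v f) x| <= e%:num.
  exact: near_t.
by case/filter_ex.
Unshelve. all: by end_near. Qed.

End Symmetry.

(** * Smooth functions on a manifold *)

Section SmoothFunctions.
Context {R : realType} {d : nat} {M : manifold R d}.
Implicit Types (x y : M) (c : chart R d M) (f g : M -> R).

Lemma near_dom c x : dom c x -> \forall y \near x, dom c y.
Proof. by move=> cx; apply: open_nbhs_nbhs; split => //; exact: dom_open. Qed.

Lemma near_cod c x : dom c x -> \forall z \near fwd c x, cod c z.
Proof.
by move=> cx; apply: open_nbhs_nbhs; split; [exact: cod_open|exact: fwd_cod].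
Qed.

Lemma fwd_cvg c x : dom c x -> {for x, continuous (fwd c)}.
Proof.
move=> cx; have := @fwd_continuous _ _ _ c.
by rewrite continuous_open_subspace; [apply; rewrite inE|exact: dom_open].
Qed.

Lemma bwd_cvg c z : cod c z -> {for z, continuous (bwd c)}.
Proof.
move=> cz; have := @bwd_continuous _ _ _ c.
by rewrite continuous_open_subspace; [apply; rewrite inE|exact: cod_open].
Qed.

Lemma near_bwd c x (P : set M) : dom c x ->
  (\forall y \near x, P y) -> \forall z \near fwd c x, P (bwd c z).
Proof.
move=> cx Px; have cb : bwd c @ fwd c x --> bwd c (fwd c x) :=
  bwd_cvg (fwd_cod cx).
by apply: (cb P); rewrite fwdK.
Qed.

Lemma near_fwd c x (P : set 'cV[R]_d) : dom c x ->
  (\forall z \near fwd c x, P z) -> \forall y \near x, P (fwd c y).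
Proof.
move=> cx Px; have cf : fwd c @ x --> fwd c x := fwd_cvg cx; exact: (cf P).
Qed.

(** Two local expressions of a function differ by a transition map, and smooth
    maps compose; so one chart suffices to test smoothness. *)
Lemma smooth_atP c x f : atlas c -> dom c x ->
  smooth_at x f <-> Cinf_at (fwd c x) (f \o bwd c : _ -> R^o).
Proof.
move=> ac cx; split=> [|fc c' ac' c'x]; first exact.
have tr : Cinf_at (fwd c' x) (fwd c \o bwd c') by exact: atlas_smooth.
apply: (Cinf_eq (f := (f \o bwd c) \o (fwd c \o bwd c'))).
  have := near_bwd c'x (near_dom cx); apply: filterS => z cz /=.
  by rewrite fwdK.
by apply: Cinf_comp => //=; rewrite fwdK.
Qed.

(** The charts around y in which smoothness at y is tested need not contain x;
    this is why independence of the chart is needed. *)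
Lemma smooth_near x f : smooth_at x f -> \forall y \near x, smooth_at y f.
Proof.
have [c ac cx] := atlas_cover x => /(_ c ac cx)/Cinf_near/(near_fwd cx) fc.
by near=> y; apply/(smooth_atP _ ac); [near: y; exact: near_dom|near: y].
Unshelve. all: by end_near. Qed.

Lemma smooth_eq x f g : (\forall y \near x, f y = g y) ->
  smooth_at x f -> smooth_at x g.
Proof.
move=> fg fx c ac cx; apply: Cinf_eq _ (fx c ac cx).
exact: (near_bwd (P := fun y => f y = g y) cx fg).
Qed.

Lemma smooth_cst x (a : R) : smooth_at x (cst a).
Proof. by move=> c ac cx; exact: (Cinf_cst (fwd c x) (a : R^o)). Qed.

Lemma smoothD x f g : smooth_at x f -> smooth_at x g ->
  smooth_at x (fun y => f y + g y).
Proof. by move=> fx gx c ac cx; apply: CinfD; [exact: fx|exact: gx]. Qed.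

Lemma smoothM x f g : smooth_at x f -> smooth_at x g ->
  smooth_at x (fun y => f y * g y).
Proof.
by move=> fx gx c ac cx; apply: (@CinfM R _ _ (f \o bwd c) (g \o bwd c));
  [exact: fx|exact: gx].
Qed.

Lemma smoothZ x a f : smooth_at x f -> smooth_at x (fun y => a * f y).
Proof. by move=> fx; apply: smoothM => //; exact: smooth_cst. Qed.

Lemma smoothN x f : smooth_at x f -> smooth_at x (fun y => - f y).
Proof.
move=> fx; apply: (smooth_eq _ (smoothZ (- 1) fx)); near=> y; exact: mulN1r.
Unshelve. all: by end_near. Qed.

Lemma smoothB x f g : smooth_at x f -> smooth_at x g ->
  smooth_at x (fun y => f y - g y).
Proof. by move=> fx gx; apply: smoothD => //; exact: smoothN. Qed.

Lemma smoothV x f : f x != 0 -> smooth_at x f ->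
  smooth_at x (fun y => (f y)^-1).
Proof.
move=> f0 fx c ac cx; apply: (@CinfV R _ _ (f \o bwd c)); last exact: fx.
by rewrite /= fwdK.
Qed.

Lemma smooth_sum x (I : Type) (r : seq I) (P : pred I) (f : I -> M -> R) :
  (forall i, P i -> smooth_at x (f i)) ->
  smooth_at x (fun y => \sum_(i <- r | P i) f i y).
Proof.
move=> fx; elim: r => [|i r IH].
  by apply: (smooth_eq _ (@smooth_cst x 0)); near=> y; rewrite big_nil.
have [Pi|nPi] := boolP (P i).
  apply: (smooth_eq _ (smoothD (fx i Pi) IH)).
  by near=> y; rewrite big_cons Pi.
by apply: (smooth_eq _ IH); near=> y; rewrite big_cons (negbTE nPi).
Unshelve. all: by end_near. Qed.

Lemma smooth_prod x (I : Type) (r : seq I) (P : pred I) (f : I -> M -> R) :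
  (forall i, P i -> smooth_at x (f i)) ->
  smooth_at x (fun y => \prod_(i <- r | P i) f i y).
Proof.
move=> fx; elim: r => [|i r IH].
  by apply: (smooth_eq _ (@smooth_cst x 1)); near=> y; rewrite big_nil.
have [Pi|nPi] := boolP (P i).
  apply: (smooth_eq _ (smoothM (fx i Pi) IH)).
  by near=> y; rewrite big_cons Pi.
by apply: (smooth_eq _ IH); near=> y; rewrite big_cons (negbTE nPi).
Unshelve. all: by end_near. Qed.

Lemma smooth_det x m (A : M -> 'M[R]_m) :
  (forall i j, smooth_at x (fun y => A y i j)) ->
  smooth_at x (fun y => \det (A y)).
Proof.
move=> Ax; apply: smooth_sum => s _; apply: smoothM; first exact: smooth_cst.
exact: smooth_prod.
Qed.

(** Cramer's rule expresses the inverse by smooth functions of the entries. *)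
Lemma smooth_inv x m (A : M -> 'M[R]_m) : A x \in unitmx ->
  (forall i j, smooth_at x (fun y => A y i j)) ->
  (\forall y \near x, A y \in unitmx) /\
  (forall i j, smooth_at x (fun y => invmx (A y) i j)).
Proof.
move=> Ax sA; have sdet := smooth_det sA.
have det0 : \det (A x) != 0 by rewrite -unitfE -unitmxE.
have Au : \forall y \near x, A y \in unitmx.
  have [c ac cx] := atlas_cover x.
  have := Cinf_cont (sdet c ac cx) => cdet.
  have det_bwd : \forall z \near fwd c x, \det (A (bwd c z)) != 0.
    by apply: (cvgr_neq0 _ cdet); rewrite /= fwdK.
  have := near_fwd cx det_bwd; have := near_dom cx; apply: filterS2 => y cy.
  by rewrite fwdK// unitmxE unitfE.
split=> // i j.
apply: (smooth_eq (f := fun y => (\det (A y))^-1 * \adj (A y) i j)).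
  by apply: filterS Au => y Ay; rewrite /invmx Ay !mxE.
apply: smoothM; first exact: smoothV.
apply: (smooth_eq (f := fun y =>
  (-1) ^+ (j + i) * \det (row' j (col' i (A y))))).
  by near=> y; rewrite mxE.
apply: smoothZ; apply: smooth_det => k l.
by apply: (smooth_eq _ (sA (lift j k) (lift i l))); near=> y; rewrite !mxE.
Unshelve. all: by end_near. Qed.

Definition chart_coord c j : M -> R := fun y => fwd c y j 0.

Definition pderiv c j f : M -> R := fun y =>
  'D_(delta_mx j 0) (f \o bwd c : _ -> R^o) (fwd c y).

Lemma smooth_chart_coord c x j : atlas c -> dom c x ->
  smooth_at x (chart_coord c j).
Proof.
move=> ac cx c' ac' c'x.
have tr : Cinf_at (fwd c' x) (fwd c \o bwd c') by exact: atlas_smooth.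
exact: (Cinf_coord j tr).
Qed.

Lemma smooth_pderiv c x j f : atlas c -> dom c x -> smooth_at x f ->
  smooth_at x (pderiv c j f).
Proof.
move=> ac cx fx; apply/(smooth_atP _ ac) => //.
apply: (Cinf_eq (f := 'D_(delta_mx j 0) (f \o bwd c : _ -> R^o))).
  have := near_cod cx; apply: filterS => z cz.
  by rewrite /pderiv /= bwdK.
by apply: Cinf_derive; exact: fx.
Qed.

Lemma pderiv_chart_coord c x j k : atlas c -> dom c x ->
  pderiv c k (chart_coord c j) x = (k == j)%:R.
Proof.
move=> ac cx; rewrite /pderiv.
have e : \forall z \near fwd c x, (chart_coord c j \o bwd c) z = z j 0 :> R^o.
  have := near_cod cx; apply: filterS => z cz.
  by rewrite /chart_coord /= bwdK.
rewrite (near_eq_derive _ e).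
rewrite (_ : (fun z : 'cV[R]_d => z j 0 : R^o) =
  (fun z : 'cV[R]_d => id z j 0)) //.
have did : derivable (id : 'cV[R]_d -> 'cV[R]_d) (fwd c x) (delta_mx k 0) by [].
have /matrixP /(_ j 0) := derive_mx did.
by rewrite derive_id !mxE eqxx andbT eq_sym => <-.
Qed.

Lemma pderiv_eq c x j f g : dom c x -> (\forall y \near x, f y = g y) ->
  pderiv c j f x = pderiv c j g x.
Proof.
by move=> cx fg; apply: near_eq_derive;
  exact: (near_bwd (P := fun y => f y = g y)).
Qed.

Lemma pderivM c x j f g : atlas c -> dom c x -> smooth_at x f ->
  smooth_at x g ->
  pderiv c j (fun y => f y * g y) x = f x * pderiv c j g x +
    g x * pderiv c j f x.
Proof.
move=> ac cx fx gx.
have df := Cinf_derivable (v := delta_mx j 0) (fx c ac cx).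
have dg := Cinf_derivable (v := delta_mx j 0) (gx c ac cx).
rewrite /pderiv (_ : _ \o bwd c =
  (f \o bwd c : _ -> R^o) * (g \o bwd c : _ -> R^o))//.
by rewrite deriveM// /= fwdK.
Qed.

Lemma pderivD c x j f g : atlas c -> dom c x -> smooth_at x f ->
  smooth_at x g ->
  pderiv c j (fun y => f y + g y) x = pderiv c j f x + pderiv c j g x.
Proof.
move=> ac cx fx gx.
have df := Cinf_derivable (v := delta_mx j 0) (fx c ac cx).
have dg := Cinf_derivable (v := delta_mx j 0) (gx c ac cx).
by rewrite /pderiv (_ :
  _ \o bwd c = (f \o bwd c : _ -> R^o) + (g \o bwd c : _ -> R^o))// deriveD.
Qed.

Lemma pderiv_cst c x j (a : R) : pderiv c j (cst a) x = 0.
Proof. by rewrite /pderiv (_ : _ \o bwd c = cst (a : R^o))// derive_cst. Qed.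

Lemma pderiv_sym c x j k f : atlas c -> dom c x -> smooth_at x f ->
  pderiv c j (pderiv c k f) x = pderiv c k (pderiv c j f) x.
Proof.
move=> ac cx fx.
have e i l : pderiv c i (pderiv c l f) x =
    'D_(delta_mx i 0) ('D_(delta_mx l 0) (f \o bwd c : _ -> R^o)) (fwd c x).
  apply: near_eq_derive.
  have := near_cod cx; apply: filterS => z cz.
  by rewrite /pderiv /= bwdK.
by rewrite !e; apply: derive_sym; exact: fx.
Qed.

End SmoothFunctions.

(** * Tangent vectors, vector fields and their brackets *)

Section TangentVectors.
Context {R : realType} {d : nat} {M : manifold R d}.
Implicit Types (x y : M) (c : chart R d M) (f g : M -> R).

Lemma tvP x (v : tangent_space x) : is_tangent x v.
Proof. by have /asboolP := tv_proof v. Qed.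

Lemma tv_nonsmooth x (v : tangent_space x) f : ~ smooth_at x f -> v f = 0.
Proof. exact: (tvP v).1. Qed.

(** The values on the coordinate functions are the components in the basis
    of partial derivatives, which is dual to them. *)
Lemma tvE c x (v : tangent_space x) f : atlas c -> dom c x -> smooth_at x f ->
  v f = \sum_j v (chart_coord c j) * pderiv c j f x.
Proof.
move=> ac cx fx; have [_ /(_ c ac cx) [w vw]] := tvP v.
have vE g : smooth_at x g -> v g = \sum_j w j 0 * pderiv c j g x.
  by move=> gx; rewrite vw// derive_cV//; exact: Cinf_diff (gx c ac cx).
rewrite vE//; apply: eq_bigr => j _; rewrite [in RHS]vE;
  last exact: smooth_chart_coord.
rewrite (bigD1 j)//= pderiv_chart_coord// eqxx mulr1 big1 ?addr0// => k kj.
by rewrite pderiv_chart_coord// (negbTE kj) mulr0.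
Qed.

Lemma tv_eq c x (u v : tangent_space x) : atlas c -> dom c x ->
  (forall j, u (chart_coord c j) = v (chart_coord c j)) -> u = v.
Proof.
move=> ac cx uv; apply: val_inj; apply/funext => f /=.
have [fx|fx] := pselect (smooth_at x f); last by rewrite !tv_nonsmooth.
by rewrite !(tvE _ ac cx fx); apply: eq_bigr => j _; rewrite uv.
Qed.

Lemma tv_cst x (v : tangent_space x) (a : R) : v (cst a) = 0.
Proof.
have [c ac cx] := atlas_cover x; rewrite (tvE _ ac cx); last exact: smooth_cst.
by rewrite big1// => j _; rewrite pderiv_cst mulr0.
Qed.

Lemma tv_local x (v : tangent_space x) f g : (\forall y \near x, f y = g y) ->
  smooth_at x f -> v f = v g.
Proof.
move=> fg fx; have [c ac cx] := atlas_cover x.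
have gx := smooth_eq fg fx.
rewrite (tvE _ ac cx fx) (tvE _ ac cx gx); apply: eq_bigr => j _.
by rewrite (pderiv_eq _ cx fg).
Qed.

Lemma tvD x (v : tangent_space x) f g : smooth_at x f -> smooth_at x g ->
  v (fun y => f y + g y) = v f + v g.
Proof.
move=> fx gx; have [c ac cx] := atlas_cover x.
rewrite !(tvE _ ac cx) -?big_split//=; last exact: smoothD.
by apply: eq_bigr => j _; rewrite pderivD// mulrDr.
Qed.

Lemma tvM x (v : tangent_space x) f g : smooth_at x f -> smooth_at x g ->
  v (fun y => f y * g y) = v f * g x + f x * v g.
Proof.
move=> fx gx; have [c ac cx] := atlas_cover x.
rewrite !(tvE _ ac cx)//; last exact: smoothM.
rewrite mulr_suml mulr_sumr -big_split/=; apply: eq_bigr => j _.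
by rewrite pderivM//; ring.
Qed.

Lemma tvZ x (v : tangent_space x) (a : R) f : smooth_at x f ->
  v (fun y => a * f y) = a * v f.
Proof.
move=> fx; rewrite (@tvM x v (cst a) f)//; last exact: smooth_cst.
by rewrite tv_cst mul0r add0r.
Qed.

Lemma tvB x (v : tangent_space x) f g : smooth_at x f -> smooth_at x g ->
  v (fun y => f y - g y) = v f - v g.
Proof.
move=> fx gx; rewrite -[- v g]mulN1r -tvZ// -tvD//; last exact: smoothZ.
by congr (tv_fun v _); apply/funext => y; rewrite mulN1r.
Qed.

Lemma tv_sum x (v : tangent_space x) (I : Type) (r : seq I) (f : I -> M -> R) :
  (forall i, smooth_at x (f i)) ->
  v (fun y => \sum_(i <- r) f i y) = \sum_(i <- r) v (f i).
Proof.
move=> fx; elim: r => [|i r IH].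
  rewrite big_nil (_ : (fun _ => _) = cst 0) ?tv_cst//.
  by apply/funext => y; rewrite big_nil.
rewrite big_cons -IH -tvD//; last exact: smooth_sum.
by congr (tv_fun v _); apply/funext => y; rewrite big_cons.
Qed.

Lemma tv_addE x (u v : tangent_space x) f : (u + v) f = u f + v f.
Proof. by []. Qed.

Lemma tv_scaleE x (a : R) (u : tangent_space x) f : (a *: u) f = a * u f.
Proof. by []. Qed.

Lemma tv_zeroE x f : (0 : tangent_space x) f = 0.
Proof. by []. Qed.

Lemma tv_sumE x (I : Type) (r : seq I) (u : I -> tangent_space x) f :
  (\sum_(i <- r) u i) f = \sum_(i <- r) u i f.
Proof.
by elim: r => [|i r IH]; rewrite ?big_nil ?tv_zeroE// !big_cons tv_addE IH.
Qed.

End TangentVectors.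

Arguments tv_local {R d M x v f g}.
Arguments tvM {R d M x v f g}.

Section Fields.
Context {R : realType} {d : nat} {M : manifold R d}.
Implicit Types (x y : M) (c : chart R d M) (f g : M -> R) (X Y Z : vfield M).

Lemma vfield_smoothP c x X : atlas c -> dom c x ->
  vfield_smooth_at x X <->
  forall j, smooth_at x (fun y => X y (chart_coord c j)).
Proof.
move=> ac cx; split=> [Xx j|Xx f fx]; first by apply: Xx;
  exact: smooth_chart_coord.
apply: (smooth_eq (f := fun y =>
  \sum_j X y (chart_coord c j) * pderiv c j f y)).
  near=> y; rewrite -(tvE _ ac)//; near: y;
    [exact: near_dom|exact: smooth_near].
apply: smooth_sum => j _; apply: smoothM; first exact: Xx.
exact: smooth_pderiv.
Unshelve. all: by end_near. Qed.

(** The definition at y quantifies over the functions smooth at y, more than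
    those smooth at x; the finitely many chart components avoid this. *)
Lemma vfield_near x X : vfield_smooth_at x X ->
  \forall y \near x, vfield_smooth_at y X.
Proof.
have [c ac cx] := atlas_cover x => /(vfield_smoothP _ ac cx) Xx.
have /filter_forall Xy : forall j,
    \forall y \near x, smooth_at y (fun y => X y (chart_coord c j)).
  by move=> j; exact: smooth_near.
near=> y; apply/(vfield_smoothP _ ac) => [|j]; first by near: y;
  exact: near_dom.
by move: j; near: y.
Unshelve. all: by end_near. Qed.

Lemma vfield_eq x X Y : (\forall y \near x, X y = Y y) ->
  vfield_smooth_at x X -> vfield_smooth_at x Y.
Proof.
move=> XY Xx f fx; apply: (smooth_eq (f := fun y => X y f)); last exact: Xx.
by apply: filterS XY => y ->.
Qed.

Lemma vfieldZ x f X : smooth_at x f -> vfield_smooth_at x X ->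
  vfield_smooth_at x (fun y => f y *: X y).
Proof. by move=> fx Xx g gx; apply: smoothM => //; exact: Xx. Qed.

Lemma vfield0 x : vfield_smooth_at x (fun=> 0).
Proof. by move=> f fx; exact: (@smooth_cst _ _ _ x 0). Qed.

Lemma vfield_sum x (I : Type) (r : seq I) (X : I -> vfield M) :
  (forall i, vfield_smooth_at x (X i)) ->
  vfield_smooth_at x (fun y => \sum_(i <- r) X i y).
Proof.
move=> Xx f fx; apply: (smooth_eq (f := fun y => \sum_(i <- r) X i y f)).
  by near=> y; rewrite tv_sumE.
by apply: smooth_sum => i _; exact: Xx.
Unshelve. all: by end_near. Qed.

(** The commutator of two smooth fields is a derivation because the second
    order terms cancel by the symmetry of second derivatives. *)
Lemma commutatorE c x X Y f : atlas c -> dom c x ->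
  vfield_smooth_at x X -> vfield_smooth_at x Y -> smooth_at x f ->
  X x (fun y => Y y f) - Y x (fun y => X y f) =
  \sum_j (X x (fun y => Y y (chart_coord c j)) -
    Y x (fun y => X y (chart_coord c j)))
    * pderiv c j f x.
Proof.
move=> ac cx; pose hess (U V : vfield M) :=
  \sum_j \sum_k V x (chart_coord c j) * U x (chart_coord c k)
    * pderiv c k (pderiv c j f) x.
have half U V : vfield_smooth_at x U -> vfield_smooth_at x V -> smooth_at x f ->
    U x (fun y => V y f) =
    \sum_j U x (fun y => V y (chart_coord c j)) * pderiv c j f x + hess U V.
  move=> Ux Vx fx; have Vc j : smooth_at x (fun y => V y (chart_coord c j)).
    by apply: Vx; exact: smooth_chart_coord.
  have pdx j : smooth_at x (pderiv c j f) by exact: smooth_pderiv.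
  rewrite -(tv_local (f := fun y =>
    \sum_j V y (chart_coord c j) * pderiv c j f y)); first last.
  - by apply: smooth_sum => j _; exact: smoothM.
  - near=> y; rewrite -(tvE _ ac)//; near: y;
    [exact: near_dom|exact: smooth_near].
  rewrite tv_sum => [|j]; last exact: smoothM.
  rewrite -big_split/=; apply: eq_bigr => j _; rewrite tvM//; congr (_ + _).
  rewrite (tvE _ ac cx (pdx j)) mulr_sumr; apply: eq_bigr => k _.
  by rewrite mulrA.
move=> Xx Yx fx.
have hess_sym : hess X Y = hess Y X.
  rewrite /hess exchange_big; apply: eq_bigr => k _; apply: eq_bigr => j _.
  by rewrite (pderiv_sym _ _ ac cx fx) [Y x _ * _]mulrC.
rewrite (half X Y Xx Yx fx) (half Y X Yx Xx fx) hess_sym.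
rewrite opprD addrACA subrr addr0 -sumrB.
by apply: eq_bigr => j _; rewrite mulrBl.
Unshelve. all: by end_near. Qed.

(** The bracket is characterized by its values on smooth functions; the point
    is that a tangent vector with these values exists. *)
Lemma bracketE x X Y f : vfield_smooth_at x X -> vfield_smooth_at x Y ->
  smooth_at x f ->
  bracket X Y x f = X x (fun y => Y y f) - Y x (fun y => X y f).
Proof.
move=> Xx Yx fx; rewrite /bracket.
set A := [set z | _]; suff : A !=set0.
  by move=> /(xgetPex 0); apply.
(* Tangent vectors vanish by convention on functions that are not smooth. *)
pose z (h : M -> R) : R^o := if `[< smooth_at x h >] then
  X x (fun y => Y y h) - Y x (fun y => X y h) else 0.
have zt : z \in tangent_pred x.
  apply/asboolP; split=> [h hx|c ac cx]; first by rewrite /z asboolF.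
  exists (\col_j (X x (fun y => Y y (chart_coord c j))
                  - Y x (fun y => X y (chart_coord c j)))) => h hx.
  rewrite /z asboolT// derive_cV; last exact: Cinf_diff (hx c ac cx).
  by rewrite (commutatorE ac cx)//; apply: eq_bigr => j _; rewrite mxE.
exists (TangentVector zt) => h hx /=.
by rewrite /z asboolT.
Qed.

Lemma bracket_smooth x X Y : vfield_smooth_at x X -> vfield_smooth_at x Y ->
  vfield_smooth_at x (bracket X Y).
Proof.
move=> Xx Yx f fx.
apply: (smooth_eq (f := fun y => X y (fun z => Y z f) - Y y (fun z => X z f))).
  near=> y; rewrite bracketE//; near: y;
    [exact: vfield_near|exact: vfield_near|exact: smooth_near].
by apply: smoothB; [apply/Xx/Yx|apply/Yx/Xx].
Unshelve. all: by end_near. Qed.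

(** On functions the double brackets are double commutators of operators, and
    the twelve terms cancel in pairs. *)
Lemma jacobi x X Y Z : vfield_smooth_at x X -> vfield_smooth_at x Y ->
  vfield_smooth_at x Z ->
  bracket (bracket X Y) Z x + bracket (bracket Y Z) X x
    + bracket (bracket Z X) Y x = 0.
Proof.
move=> Xx Yx Zx; have [c ac cx] := atlas_cover x.
apply: (tv_eq ac cx) => j; have := smooth_chart_coord j ac cx.
move: (chart_coord c j) => f fx; rewrite !tv_addE tv_zeroE.
have half U V W : vfield_smooth_at x U -> vfield_smooth_at x V ->
  vfield_smooth_at x W ->
    bracket (bracket U V) W x f =
    U x (fun y => V y (fun z => W z f)) - V x (fun y => U y (fun z => W z f)) -
    (W x (fun y => U y (fun z => V z f)) - W x (fun y => V y (fun z => U z f))).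
  move=> Ux Vx Wx; have UVx := bracket_smooth Ux Vx.
  rewrite bracketE// bracketE//; last exact: Wx.
  have sUV : smooth_at x (fun y => U y (fun z => V z f)) by apply/Ux/Vx.
  have sVU : smooth_at x (fun y => V y (fun z => U z f)) by apply/Vx/Ux.
  have Wbr : W x (fun y => U y (fun z => V z f) - V y (fun z => U z f)) =
      W x (fun y => bracket U V y f).
    apply: tv_local; last exact: smoothB.
    near=> y; rewrite bracketE//; near: y;
      [exact: vfield_near|exact: vfield_near|exact: smooth_near].
  by rewrite -Wbr tvB.
by rewrite !half//; ring.
Unshelve. all: by end_near. Qed.

End Fields.

(** * Covariant derivatives in local frames *)

Section LinearMaps.
Context {R : realType} {d : nat} {W : lmodType R}.
Variables (p : 'cV[R]_d -> W) (lp : linear p).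

Let pl : {linear 'cV[R]_d -> W} :=
  HB.pack p (GRing.isLinear.Build _ _ _ _ p lp).

Lemma lin0 : p 0 = 0. Proof. exact: (linear0 pl). Qed.
Lemma linD u v : p (u + v) = p u + p v. Proof. exact: (linearD pl). Qed.
Lemma linN u : p (- u) = - p u. Proof. exact: (linearN pl). Qed.
Lemma linB u v : p (u - v) = p u - p v. Proof. exact: (linearB pl). Qed.
Lemma linZ a u : p (a *: u) = a *: p u. Proof. exact: (linearZ_LR pl). Qed.
Lemma lin_sum (I : Type) (r : seq I) (F : I -> 'cV[R]_d) :
  p (\sum_(i <- r) F i) = \sum_(i <- r) p (F i).
Proof. exact: (linear_sum pl). Qed.

Lemma lin_delta u : p u = \sum_i u i 0 *: p (delta_mx i 0).
Proof.
rewrite {1}[u]matrix_sum_delta lin_sum; apply: eq_bigr => i _.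
by rewrite big_ord1 linZ.
Qed.

End LinearMaps.

Section LocalFrames.
Context {R : realType} {d : nat} {M : manifold R d}.
Local Notation V := 'cV[R]_d.
Implicit Types (x y : M) (c : chart R d M).

Definition local_frame x (s : forall y : M, V -> tangent_space y) : Prop :=
  (\forall y \near x, is_frame (s y)) /\
  forall w, vfield_smooth_at x (fun y => s y w).

Definition frame_matrix c (s : forall y : M, V -> tangent_space y) y
  : 'M[R]_d :=
  \matrix_(j, i) s y (delta_mx i 0) (chart_coord c j).

Lemma frame_matrixE c (s : forall y : M, V -> tangent_space y) y u j :
  linear (s y) -> s y u (chart_coord c j) = (frame_matrix c s y *m u) j 0.
Proof.
move=> ls; rewrite (lin_delta ls) tv_sumE mxE; apply: eq_bigr => i _.
by rewrite tv_scaleE !mxE mulrC.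
Qed.

Lemma frame_matrix_unit c (s : forall y : M, V -> tangent_space y) y :
  atlas c -> dom c y -> is_frame (s y) -> frame_matrix c s y \in unitmx.
Proof.
move=> ac cy [ls /bij_inj si].
rewrite -unitmx_tr -row_free_unit -kermx_eq0; apply/rowV0P => v /sub_kermxP vA.
apply: trmx_inj; rewrite trmx0; apply: si; rewrite (lin0 ls).
apply: (tv_eq ac cy) => j; rewrite frame_matrixE// tv_zeroE.
by rewrite -[_ *m v^T]trmxK trmx_mul trmxK vA !mxE.
Qed.

(** In a chart the components are obtained by inverting the matrix of the
    frame. *)
Lemma smooth_components x s (Y : vfield M) : local_frame x s ->
  vfield_smooth_at x Y ->
  exists2 Yc : M -> V, (forall i, smooth_at x (fun y => Yc y i 0)) &
    \forall y \near x, Y y = s y (Yc y).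
Proof.
move=> [fs ss] Yx; have [c ac cx] := atlas_cover x.
have sS i j : smooth_at x (fun y => frame_matrix c s y i j).
  apply: (smooth_eq (f := fun y => s y (delta_mx j 0) (chart_coord c i))).
    by near=> y; rewrite mxE.
  by apply: ss; exact: smooth_chart_coord.
have [unS sSi] := smooth_inv (frame_matrix_unit ac cx (nbhs_singleton fs)) sS.
exists (fun y => invmx (frame_matrix c s y) *m \col_j Y y (chart_coord c j)).
  move=> i; apply: (smooth_eq (f := fun y =>
     \sum_j invmx (frame_matrix c s y) i j * Y y (chart_coord c j))).
    by near=> y; rewrite mxE; apply: eq_bigr => j _; rewrite mxE.
  apply: smooth_sum => j _; apply: smoothM; first exact: sSi.
  by apply: Yx; exact: smooth_chart_coord.
near=> y; have cy : dom c y by near: y; exact: near_dom.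
have fy : is_frame (s y) by near: y.
apply: (tv_eq ac cy) => j; rewrite (frame_matrixE _ _ _ fy.1).
by rewrite mulmxA mulmxV ?mul1mx ?mxE//; near: y.
Unshelve. all: by end_near. Qed.

Lemma smooth_combination x s (Yc : M -> V) : local_frame x s ->
  (forall i, smooth_at x (fun y => Yc y i 0)) ->
  vfield_smooth_at x (fun y => s y (Yc y)).
Proof.
move=> [fs ss] sY.
apply: (vfield_eq (X := fun y => \sum_i Yc y i 0 *: s y (delta_mx i 0))).
  by apply: filterS fs => y [ls _]; rewrite [RHS](lin_delta ls).
by apply: vfield_sum => i; apply: vfieldZ; [exact: sY|exact: ss].
Qed.

Variable D : connection M.

Lemma nabla0 x (v : tangent_space x) : D x v (fun=> 0) = 0.
Proof.
have := nabla_additive D v (@vfield0 _ _ _ x) (@vfield0 _ _ _ x).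
rewrite (_ : (fun y => 0 + 0) = (fun y : M => 0 : tangent_space y)).
  by move=> /eqP; rewrite -subr_eq0 opprD addNKr oppr_eq0 => /eqP.
by apply: functional_extensionality_dep => y; rewrite addr0.
Qed.

Lemma nabla_comb x (v : tangent_space x) (I : Type) (r : seq I)
    (f : I -> M -> R) (X : I -> vfield M) :
  (forall i, smooth_at x (f i)) -> (forall i, vfield_smooth_at x (X i)) ->
  D x v (fun y => \sum_(i <- r) f i y *: X i y) =
  \sum_(i <- r) (v (f i) *: X i x + f i x *: D x v (X i)).
Proof.
move=> fx Xx; elim: r => [|i r IH].
  rewrite big_nil -[RHS](nabla0 v); congr (nabla D v _).
  by apply: functional_extensionality_dep => y; rewrite big_nil.
rewrite big_cons -IH -(nabla_leibniz D v (fx i) (Xx i)) -nabla_additive.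
- congr (nabla D v _).
  by apply: functional_extensionality_dep => y; rewrite big_cons.
- exact: vfieldZ.
- by apply: vfield_sum => j; exact: vfieldZ.
Qed.

(** By the Leibniz rule with constant coefficients, the covariant derivative is
    linear on the frame fields s w. *)
Lemma Lambda_exists x s u : local_frame x s -> exists L, is_Lambda D s x u L.
Proof.
move=> [fs ss]; have [ls [g sg gs]] := nbhs_singleton fs.
exists (\matrix_(j, i) (g (D x (s x u) (fun y => s y (delta_mx i 0)))) j 0) =>
  w.
rewrite -(@nabla_local _ _ _ D x (s x u) (fun y =>
  \sum_i cst (w i 0) y *: s y (delta_mx i 0))).
- rewrite nabla_comb => [|i|i]; last exact: ss.
    under eq_bigr do rewrite tv_cst scale0r add0r.
    transitivity (s x (\sum_i w i 0 *:
      g (D x (s x u) (fun y => s y (delta_mx i 0))))).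
      by rewrite lin_sum//; apply: eq_bigr => i _; rewrite linZ// gs.
    congr (s x _); apply/colP => j.
    rewrite !mxE summxE; apply: eq_bigr => i _.
    by rewrite !mxE mulrC.
  exact: smooth_cst.
- by apply: vfield_sum => i; apply: vfieldZ; [exact: smooth_cst|exact: ss].
- by apply: filterS fs => y [ly _]; rewrite [RHS](lin_delta ly).
Qed.

(** Leibniz rule in a frame: the covariant derivative differentiates the
    components and lets the connection matrix act on them. *)
Lemma nabla_frame x s u L Y (Yc : M -> V) : local_frame x s ->
  is_Lambda D s x u L -> (forall i, smooth_at x (fun y => Yc y i 0)) ->
  (\forall y \near x, Y y = s y (Yc y)) ->
  D x (s x u) Y = s x (\col_i s x u (fun y => Yc y i 0) + L *m Yc x).
Proof.
move=> [fs ss] sL sY YE; have [ls _] := nbhs_singleton fs.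
rewrite -(@nabla_local _ _ _ D x (s x u) (fun y =>
  \sum_i Yc y i 0 *: s y (delta_mx i 0))).
- rewrite (nabla_comb _ _ sY); last by move=> i; exact: ss.
  rewrite big_split/= (linD ls) (lin_delta ls (\col_i _)).
  congr (_ + _); first by apply: eq_bigr => i _; rewrite mxE.
  rewrite {2}[Yc x]matrix_sum_delta mulmx_sumr (lin_sum ls).
  apply: eq_bigr => i _; rewrite big_ord1 -scalemxAr (linZ ls).
  by rewrite sL.
- by apply: vfield_sum => i; apply: vfieldZ; [exact: sY|exact: ss].
- near=> y; have [ly _] : is_frame (s y) by near: y.
  by rewrite -(lin_delta ly); apply/esym; near: y.
Unshelve. all: by end_near. Qed.

Lemma local_frame_near x s : local_frame x s ->
  \forall y \near x, local_frame y s.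
Proof.
move=> [fs ss]; have fss := near_join fs.
have /filter_forall sss : forall i : 'I_d,
    \forall y \near x, vfield_smooth_at y (fun z => s z (delta_mx i 0)).
  by move=> i; exact: vfield_near.
near=> y; have fy : \forall z \near y, is_frame (s z) by near: y.
have sy : forall i, vfield_smooth_at y (fun z => s z (delta_mx i 0)) by near: y.
split=> // w.
apply: (vfield_eq (X := fun z => \sum_i w i 0 *: s z (delta_mx i 0))).
  by apply: filterS fy => z [lz _]; rewrite [RHS](lin_delta lz).
apply: vfield_sum => i.
by apply: (vfieldZ (f := cst (w i 0))); [exact: smooth_cst|exact: sy].
Unshelve. all: by end_near. Qed.

Lemma local_section_frame (G : set 'M[R]_d) (P : frames M) x s :
  is_Gstructure G P -> local_section P x s -> local_frame x s.
Proof.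
move=> GP [Ps ss]; split=> //.
by apply: filterS Ps => y Py; exact: (Gs_frame GP Py).
Qed.

Lemma local_section_near (G : set 'M[R]_d) (P : frames M) x s :
  is_Gstructure G P -> local_section P x s ->
  \forall y \near x, local_section P y s.
Proof.
move=> GP Ps; have /local_frame_near := local_section_frame GP Ps.
have := near_join Ps.1; apply: filterS2 => y Py [_ sy].
by split.
Qed.

End LocalFrames.

(** * Linear algebra of the unitary structure *)

Section Inner.
Context {R : realType} {d : nat}.
Implicit Types (u v w : 'cV[R]_d) (A B : 'M[R]_d).

Definition inner u v : R := (u^T *m v) 0 0.

Lemma innerC u v : inner u v = inner v u.
Proof. by rewrite /inner -[u^T *m v]trmxK trmx_mul trmxK mxE. Qed.

Lemma innerDl u v w : inner (u + v) w = inner u w + inner v w.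
Proof. by rewrite /inner linearD mulmxDl mxE. Qed.

Lemma innerDr u v w : inner u (v + w) = inner u v + inner u w.
Proof. by rewrite /inner mulmxDr mxE. Qed.

Lemma innerZl a u v : inner (a *: u) v = a * inner u v.
Proof. by rewrite /inner linearZ -scalemxAl mxE. Qed.

Lemma innerZr a u v : inner u (a *: v) = a * inner u v.
Proof. by rewrite /inner -scalemxAr mxE. Qed.

Lemma innerNl u v : inner (- u) v = - inner u v.
Proof. by rewrite -scaleN1r innerZl mulN1r. Qed.

Lemma innerNr u v : inner u (- v) = - inner u v.
Proof. by rewrite -scaleN1r innerZr mulN1r. Qed.

Lemma inner0l v : inner 0 v = 0.
Proof. by rewrite /inner trmx0 mul0mx mxE. Qed.

Lemma inner0r v : inner v 0 = 0.
Proof. by rewrite innerC inner0l. Qed.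

Lemma innerE u v : inner u v = \sum_i u i 0 * v i 0.
Proof. by rewrite /inner mxE; apply: eq_bigr => i _; rewrite mxE. Qed.

Lemma inner_mull A u v : inner (A *m u) v = inner u (A^T *m v).
Proof. by rewrite /inner trmx_mul mulmxA. Qed.

Lemma inner_gt0 u : u != 0 -> 0 < inner u u.
Proof.
move=> u0; rewrite innerE lt_neqAle eq_sym sumr_ge0 => [|i _];
  last exact: sqr_ge0.
rewrite andbT; apply: contra_neq u0 => /eqP; rewrite psumr_eq0 => [|i _];
  last exact: sqr_ge0.
move/allP => u0; apply/colP => i; have := u0 i (mem_index_enum _).
by rewrite mulf_eq0 orbb mxE => /eqP.
Qed.

Lemma inner_skew A u : A^T = - A -> inner (A *m u) u = 0.
Proof.
move=> Ask; have : inner (A *m u) u = - inner (A *m u) u.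
  by rewrite {1}inner_mull Ask mulNmx innerNr innerC.
by move=> /eqP; rewrite -subr_eq0 opprK -mulr2n mulrn_eq0 => /eqP.
Qed.

End Inner.

Definition inner_bilin := (@innerDl, @innerDr, @innerNl, @innerNr, @innerZl,
  @innerZr, @inner0l, @inner0r).

Section UnitaryAlgebra.
Context {R : realType} {n : nat}.
Local Notation V := 'cV[R]_(n + n + 1).
Implicit Types (B : 'M[R]_(n + n)) (A : 'M[R]_(n + n + 1)).

Local Notation J := (J0 : 'M[R]_(n + n)).

Lemma J0T : J^T = - J.
Proof.
by rewrite /J0 tr_block_mx opp_block_mx !trmx0 linearN /= trmx1 oppr0 opprK.
Qed.

Lemma J0J0 : J *m J = - 1%:M.
Proof.
rewrite /J0 mulmx_block !mul0mx !mulmx0 !mulmx1 !add0r addr0 mul1mx.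
by rewrite scalar_mx_block opp_block_mx !oppr0.
Qed.

Lemma realify_J0 (U : 'M[R[i]]_n) : realify U *m J = J *m realify U.
Proof.
rewrite /J0 /realify !mulmx_block !mul0mx !mulmx0 !mulmx1 !mul1mx !add0r !addr0.
by rewrite !mulmxN !mulmx1 !mulNmx !mul1mx.
Qed.

Lemma realify1 : realify (1%:M : 'M[R[i]]_n) = 1%:M.
Proof.
rewrite /realify [RHS]scalar_mx_block; congr block_mx; apply/matrixP => i j;
  rewrite !mxE; case: (i == j); rewrite ?oppr0//.
Qed.

Lemma realifyM (U W : 'M[R[i]]_n) : realify (U *m W) = realify U *m realify W.
Proof.
have ReM : map_mx (@complex.Re R) (U *m W) =
    map_mx (@complex.Re R) U *m map_mx (@complex.Re R) W -
    map_mx (@complex.Im R) U *m map_mx (@complex.Im R) W.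
  apply/matrixP => i j; rewrite !mxE (raddf_sum (@complex.Re R)) -sumrB.
  by apply: eq_bigr => k _; rewrite !mxE; case: (U i k) (W k j) => [? ?] [? ?].
have ImM : map_mx (@complex.Im R) (U *m W) =
    map_mx (@complex.Re R) U *m map_mx (@complex.Im R) W +
    map_mx (@complex.Im R) U *m map_mx (@complex.Re R) W.
  apply/matrixP => i j; rewrite !mxE (raddf_sum (@complex.Im R)) -big_split.
  by apply: eq_bigr => k _; rewrite !mxE; case: (U i k) (W k j) => [? ?] [? ?].
rewrite /realify mulmx_block ReM ImM !mulmxN !mulNmx opprD; congr block_mx.
- by rewrite addrC.
- by rewrite addrC.
Qed.

Lemma realify_tr (U : 'M[R[i]]_n) : realify (U ^t* )%sesqui = (realify U)^T.
Proof.
rewrite /realify tr_block_mx; congr block_mx; apply/matrixP => i j;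
  by rewrite !mxE; case: (U j i) => // ? ?; rewrite /= ?opprK.
Qed.

Lemma realifyN (U : 'M[R[i]]_n) : realify (- U) = - realify U.
Proof.
rewrite /realify opp_block_mx; congr block_mx; apply/matrixP => i j;
  by rewrite !mxE; case: (U i j).
Qed.

(** The extension of J0 to V that represents phi in the frames. *)
Definition Phi0 : 'M[R]_(n + n + 1) := block_mx J 0 0 0.

Local Notation e := (evec : V).

Lemma Phi0T : Phi0^T = - Phi0.
Proof. by rewrite /Phi0 tr_block_mx opp_block_mx !trmx0 !oppr0 J0T. Qed.

Lemma Phi0_Phi0 u : Phi0 *m (Phi0 *m u) = - u + inner e u *: e.
Proof.
rewrite /Phi0 /evec /inner mulmxA mulmx_block !mul0mx !mulmx0 !addr0 J0J0.
rewrite -[u]vsubmxK mul_block_col tr_col_mx mul_row_col trmx0 trmx1 !mul0mx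
  mul1mx.
rewrite add0r !addr0 mulNmx mul1mx opp_col_mx scale_col_mx scaler0 add_col_mx
  addr0.
by congr col_mx; apply/matrixP => i j;
  rewrite !ord1 !mxE eqxx mulr1 add0r addNr.
Qed.

Lemma Phi0_e : Phi0 *m e = 0.
Proof. by rewrite /Phi0 /evec mul_block_col !mulmx0 !mul0mx !addr0 col_mx0. Qed.

Lemma Un1P A : Un1 A ->
  [/\ A^T *m A = 1%:M, A *m Phi0 = Phi0 *m A & A *m e = e].
Proof.
move=> [U Uu ->].
have UU : (realify U)^T *m realify U = 1%:M.
  by rewrite -realify_tr -realifyM (_ : _ *m U = 1%:M) ?realify1//;
    apply/mulmx1C/unitarymxP.
have := realify_J0 U; rewrite /Phi0 /evec; move: J (realify U) UU => j B BB Bj.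
rewrite tr_block_mx !mulmx_block mul_block_col.
rewrite !trmx0 !mulmx0 !mul0mx !mulmx1 ?mul1mx !addr0 !add0r trmx1 BB Bj;
  split=> //.
by rewrite [RHS]scalar_mx_block.
Qed.

Lemma un0P A : un0 A -> [/\ A^T = - A, A *m Phi0 = Phi0 *m A & A *m e = 0].
Proof.
move=> [U Uu ->].
have Usk : (realify U)^T = - realify U by rewrite -realify_tr Uu realifyN.
have := realify_J0 U; rewrite /Phi0 /evec;
  move: J (realify U) Usk => j B Bsk Bj.
rewrite tr_block_mx opp_block_mx !mulmx_block mul_block_col.
by rewrite !trmx0 !mulmx0 !mul0mx !addr0 !oppr0 col_mx0 Bsk Bj.
Qed.

Lemma un0_0 : un0 (0 : 'M[R]_(n + n + 1)).
Proof.
exists 0; last first.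
  rewrite -[LHS]block_mx0; congr block_mx; rewrite /realify.
  by rewrite -[LHS]block_mx0; congr block_mx; apply/matrixP => i j;
    rewrite !mxE ?oppr0.
by apply/matrixP => i j; rewrite !mxE rmorph0 oppr0.
Qed.

End UnitaryAlgebra.

(** * The inner torsion matrices *)

Section LambdaAlgebra.
Context {R : realType} {n : nat}.
Local Notation V := 'cV[R]_(n + n + 1).
Local Notation e := (evec : V).
Local Notation Phi := (Phi0 : 'M[R]_(n + n + 1)).
Implicit Types (u v w : V).

Lemma inner_ee : inner e e = 1.
Proof.
by rewrite /inner /evec tr_col_mx mul_row_col trmx0 trmx1 mul0mx mul1mx add0r
  mxE.
Qed.

Lemma inner_e u : inner e u = dsubmx u 0 0.
Proof.
by rewrite /inner /evec tr_col_mx -{1}[u]vsubmxK mul_row_col trmx0 trmx1 mul0mx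
  mul1mx add0r.
Qed.

Lemma inner_Phil u v : inner (Phi *m u) v = - inner u (Phi *m v).
Proof. by rewrite inner_mull Phi0T mulNmx innerNr. Qed.

Lemma inner_e_Phi u : inner e (Phi *m u) = 0.
Proof. by rewrite innerC inner_Phil Phi0_e /inner mulmx0 mxE oppr0. Qed.

Lemma inner_Phi_Phi u v :
  inner (Phi *m u) (Phi *m v) = inner u v - inner e u * inner e v.
Proof.
rewrite inner_Phil Phi0_Phi0 innerDr innerNr innerZr opprD opprK.
by rewrite [inner u e]innerC mulrC.
Qed.

(** The matrix of inner torsion sends e to this horizontal vector, up to a
    multiple of e; for a metric connection it is the derivative of xi. *)
Definition xi_deriv al be u : V :=
  al *: (u - inner e u *: e) + be *: (Phi *m u).

Definition lambda_mx (a b al be ga de : R) u : 'M[R]_(n + n + 1) :=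
  lambda a b al be ga de (usubmx u) (dsubmx u 0 0).

(** Written with e, Phi0 and the Euclidean product only, lambda can be
    compared with the geometric tensors without matrix blocks. *)
Lemma lambda_mxE a b al be ga de u w : lambda_mx a b al be ga de u *m w =
  (a * inner e u) *: (w - inner e w *: e) + inner e w *: xi_deriv al be u +
  (inner (xi_deriv ga de u) w + b * inner e u * inner e w) *: e.
Proof.
have zE x y : xi_deriv x y u = col_mx (x *: usubmx u + y *: (J0 *m usubmx u)) 0.
  rewrite /xi_deriv inner_e /Phi0 /evec -{1 3}[u]vsubmxK mul_block_col !mul0mx
    !addr0.
  rewrite !scale_col_mx opp_col_mx !add_col_mx !scale_col_mx add_col_mx
    !scaler0.
  rewrite oppr0 !addr0; congr (col_mx _ _); apply/matrixP => i j.
  by rewrite !ord1 !mxE mulr1 subrr mulr0.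
rewrite /lambda_mx /lambda !zE !inner_e /evec.
move: (al *: _ + _) (ga *: _ + _) (dsubmx u 0 0) => z z' s.
rewrite /inner -[w]vsubmxK tr_col_mx trmx0 mul_row_col mul0mx addr0 col_mxKd.
move: (usubmx w) (dsubmx w) => X t.
rewrite mul_block_col !scale_col_mx !scaler0 opp_col_mx oppr0 add_col_mx addr0.
rewrite scale_col_mx !add_col_mx !addr0 mul_scalar_mx {1}[t]mx11_scalar
  mul_mx_scalar.
congr col_mx; apply/matrixP => i j.
by rewrite !ord1 !mxE !big_ord1 !mxE /= !mulr1n; ring.
Qed.

End LambdaAlgebra.

(** * The tensors of a U(n) x 1 structure *)

Section StructureTensors.
Context {R : realType} {n : nat} {M : manifold R (n + n + 1)}.
Local Notation V := 'cV[R]_(n + n + 1).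
Local Notation e := (evec : V).
Local Notation Phi := (Phi0 : 'M[R]_(n + n + 1)).
Implicit Types (x y : M) (u v w : V).
Variables (P : frames M) (GP : is_Gstructure Un1 P).
Arguments P : clear implicits.

Lemma frame_nonempty x : exists p, P x p.
Proof. by have [s [/nbhs_singleton Ps _]] := Gs_section GP x; exists (s x). Qed.

Lemma frame_atP x : P x (frame_at P x).
Proof.
by have [p Pp] := frame_nonempty x;
  exact: (xgetPex (fun=> 0) (ex_intro _ p Pp)).
Qed.

Lemma coordK x (v : tangent_space x) : frame_at P x (Defs.coord P v) = v.
Proof.
have [_ [g _ gK]] := Gs_frame GP (frame_atP x).
exact: (xgetPex 0 (ex_intro (fun u => frame_at P x u = v) (g v) (gK v))).
Qed.

Lemma frame_inj x p : P x p -> injective p.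
Proof. by move=> /(Gs_frame GP)[_ /bij_inj]. Qed.

Lemma frame_surj x p (v : tangent_space x) : P x p -> exists u, v = p u.
Proof. by move=> /(Gs_frame GP)[_ [g _ gK]]; exists (g v). Qed.

Lemma frame_linear x p : P x p -> linear p.
Proof. by move=> /(Gs_frame GP)[]. Qed.

(** The geometric tensors are read in a chosen frame, which differs from p by an
    element of U(n) x 1; as these preserve the product, Phi0 and e, the tensors
    have the same expression in p. *)
Lemma frame_change x p : P x p ->
  exists2 A, Un1 A &
    forall u, frame_at P x u = p (A *m u) /\ A *m Defs.coord P (p u) = u.
Proof.
move=> Pp; have [A GA fA] := Gs_transitive GP Pp (frame_atP x).
exists A => // u; rewrite fA; split=> //; apply: (frame_inj Pp).
by rewrite -[RHS]coordK fA.
Qed.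

Lemma gmetricE x p u w : P x p -> gmetric P (p u) (p w) = inner u w.
Proof.
move=> /frame_change[A /Un1P[AA _ _] Ap].
rewrite -(Ap u).2 -(Ap w).2 inner_mull mulmxA !(Ap _).2 AA mul1mx.
rewrite /gmetric /hmetric /eta /h0 /inner.
move: (Defs.coord P _) (Defs.coord P _) => u' w'.
rewrite -[in RHS](vsubmxK u') -[in RHS](vsubmxK w') tr_col_mx mul_row_col
  [RHS]mxE.
by congr (_ + _); rewrite [RHS]mxE big_ord1 [in RHS]mxE.
Qed.

Lemma etaE x p u : P x p -> eta P (p u) = inner e u.
Proof.
move=> /frame_change[A /Un1P[AA _ Ae] Ap].
by rewrite /eta -inner_e -{2}(Ap u).2 -{2}Ae inner_mull mulmxA AA mul1mx.
Qed.

Lemma xiE x p : P x p -> xi P x = p e.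
Proof. by move=> /frame_change[A /Un1P[_ _ Ae] Ap];
  rewrite /xi (Ap _).1 Ae. Qed.

Lemma phiE x p u : P x p -> phi P (p u) = p (Phi *m u).
Proof.
move=> /frame_change[A /Un1P[_ AP _] Ap]; rewrite /phi (Ap _).1; congr p.
rewrite -{2}(Ap u).2 mulmxA -AP -mulmxA; congr (_ *m _).
move: (Defs.coord P _) => u';
  rewrite /Phi0 /H0vec -{2}[u']vsubmxK mul_block_col.
by rewrite !mul0mx !addr0.
Qed.

Lemma HdistE x p u : P x p -> Hdist P (p u) -> inner e u = 0.
Proof.
move=> Pp [X]; rewrite -(etaE u Pp) => ->.
by rewrite (etaE _ (frame_atP x)) inner_e /H0vec col_mxKd mxE.
Qed.

Lemma smooth_inner x (Y Z : M -> V) :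
  (forall i, smooth_at x (fun y => Y y i 0)) ->
  (forall i, smooth_at x (fun y => Z y i 0)) ->
    smooth_at x (fun y => inner (Y y) (Z y)).
Proof.
move=> sY sZ; apply: (smooth_eq (f := fun y => \sum_i Y y i 0 * Z y i 0)).
  by near=> y; rewrite innerE.
by apply: smooth_sum => i _; exact: smoothM.
Unshelve. all: by end_near. Qed.

Lemma tv_inner x (v : tangent_space x) (Y Z : M -> V) :
  (forall i, smooth_at x (fun y => Y y i 0)) ->
  (forall i, smooth_at x (fun y => Z y i 0)) ->
  v (fun y => inner (Y y) (Z y)) =
  inner (\col_i v (fun y => Y y i 0)) (Z x) +
    inner (Y x) (\col_i v (fun y => Z y i 0)).
Proof.
move=> sY sZ; rewrite -(@tv_local _ _ _ _ v (fun y =>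
  \sum_i Y y i 0 * Z y i 0)).
- rewrite tv_sum => [|i]; last exact: smoothM.
  rewrite !innerE -big_split/=; apply: eq_bigr => i _.
  by rewrite tvM// !mxE.
- by near=> y; rewrite innerE.
- by apply: smooth_sum => i _; exact: smoothM.
Unshelve. all: by end_near. Qed.

Lemma smooth_mulmx x (A : 'M[R]_(n + n + 1)) (Y : M -> V) :
  (forall i, smooth_at x (fun y => Y y i 0)) ->
  forall i, smooth_at x (fun y => (A *m Y y) i 0).
Proof.
move=> sY i; apply: (smooth_eq (f := fun y => \sum_j A i j * Y y j 0)).
  by near=> y; rewrite mxE.
by apply: smooth_sum => j _; exact: smoothZ.
Unshelve. all: by end_near. Qed.

Lemma tv_mulmx x (v : tangent_space x) (A : 'M[R]_(n + n + 1)) (Y : M -> V) :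
  (forall i, smooth_at x (fun y => Y y i 0)) ->
  \col_i v (fun y => (A *m Y y) i 0) = A *m \col_i v (fun y => Y y i 0).
Proof.
move=> sY; apply/colP => i; rewrite !mxE.
rewrite -(@tv_local _ _ _ _ v (fun y => \sum_j A i j * Y y j 0)).
- rewrite tv_sum => [|j]; last exact: smoothZ.
  by apply: eq_bigr => j _; rewrite tvZ// mxE.
- by near=> y; rewrite mxE.
- by apply: smooth_sum => j _; exact: smoothZ.
Unshelve. all: by end_near. Qed.

Lemma xi_smooth x : vfield_smooth_at x (xi P).
Proof.
have [s [Ps ss]] := Gs_section GP x.
by apply: (vfield_eq (X := fun y => s y e)) (ss e);
  apply: filterS Ps => y /xiE ->.
Qed.

(** These tensors have constant components in the frames of the structure, so
    they are smooth. *)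
Lemma structure_almost_contact :
  almost_contact_metric (phi P) (xi P) (eta P) (gmetric P).
Proof.
have lin x := frame_linear (frame_atP x).
split.
- move=> x a u v; have Pp := frame_atP x; have lp := lin x.
  have [u' ->] := frame_surj u Pp; have [v' ->] := frame_surj v Pp.
  by rewrite -lp !phiE// mulmxDr -scalemxAr lp.
- move=> x a u v; have Pp := frame_atP x; have lp := lin x.
  have [u' ->] := frame_surj u Pp; have [v' ->] := frame_surj v Pp.
  by rewrite -lp !etaE// innerDr innerZr.
- move=> x X Xx; have [s sP] := Gs_section GP x; have [Ps ss] := sP.
  have sf := local_section_frame GP sP.
  have [Xc sX XE] := smooth_components sf Xx.
  apply: (vfield_eq (X := fun y => s y (Phi *m Xc y))).
    by apply: filterS2 Ps XE => y Py ->; rewrite phiE.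
  by apply: smooth_combination => //; exact: smooth_mulmx.
- move=> x X Xx; have [s sP] := Gs_section GP x; have [Ps ss] := sP.
  have sf := local_section_frame GP sP.
  have [Xc sX XE] := smooth_components sf Xx.
  apply: (smooth_eq (f := fun y => inner e (Xc y))).
    by apply: filterS2 Ps XE => y Py ->; rewrite etaE.
  by apply: smooth_inner => // i; exact: (@smooth_cst _ _ _ x (e i 0)).
- exact: xi_smooth.
- split.
  + move=> x Y Z Yx Zx; have [s sP] := Gs_section GP x; have [Ps ss] := sP.
    have sf := local_section_frame GP sP.
    have [Yc sY YE] := smooth_components sf Yx.
    have [Zc sZ ZE] := smooth_components sf Zx.
    apply: (smooth_eq (f := fun y => inner (Yc y) (Zc y)));
      last exact: smooth_inner.
    by apply: filterS3 Ps YE ZE => y Py -> ->; rewrite gmetricE.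
  + move=> x w a u v; have Pp := frame_atP x; have lp := lin x.
    have [u' ->] := frame_surj u Pp; have [v' ->] := frame_surj v Pp.
    have [w' ->] := frame_surj w Pp.
    by rewrite -lp !gmetricE// innerDl innerZl.
  + move=> x v w; have Pp := frame_atP x; have lp := lin x.
    have [w' ->] := frame_surj w Pp; have [v' ->] := frame_surj v Pp.
    by rewrite !gmetricE// innerC.
  + move=> x v v0; have Pp := frame_atP x; have lp := lin x.
    move: v0; have [v' ->] := frame_surj v Pp => v0.
    rewrite gmetricE//; apply: inner_gt0; apply: contra_neq v0 => ->.
    exact: lin0.
- move=> x v; have Pp := frame_atP x; have lp := lin x.
  have [v' ->] := frame_surj v Pp.
  by rewrite !phiE// etaE// (xiE Pp) Phi0_Phi0 (linD lp) (linN lp) (linZ lp).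
- by move=> x; have Pp := frame_atP x; rewrite (xiE Pp) etaE// inner_ee.
- move=> x v w; have Pp := frame_atP x.
  have [w' ->] := frame_surj w Pp; have [v' ->] := frame_surj v Pp.
  by rewrite !phiE// !gmetricE// !etaE// inner_Phi_Phi.
Qed.

End StructureTensors.

(** * Connection matrices and compatibility with the metric *)

Lemma horizontal_vector (R : realType) (n : nat) : (1 <= n)%N ->
  exists2 h : 'cV[R]_(n + n + 1), h != 0 &
    inner (evec : 'cV[R]_(n + n + 1)) h = 0.
Proof.
move=> n1; have i : 'I_(n + n) by case: n n1 => // m _; exact: ord0.
exists (H0vec (delta_mx i 0)); last by rewrite inner_e /H0vec col_mxKd mxE.
apply/eqP => /(congr1 (fun v : 'cV[R]_(n + n + 1) => usubmx v i 0)).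
by rewrite /H0vec col_mxKu !mxE !eqxx => /eqP; rewrite oner_eq0.
Qed.

Section Connection.
Context {R : realType} {n : nat} {M : manifold R (n + n + 1)}.
Local Notation V := 'cV[R]_(n + n + 1).
Local Notation e := (evec : V).
Local Notation Phi := (Phi0 : 'M[R]_(n + n + 1)).
Implicit Types (x y : M) (u v w : V).
Variables (D : connection M) (P : frames M).
Arguments P : clear implicits.
Variables (T0 : V -> V -> V) (R0 : V -> V -> 'M[R]_(n + n + 1))
    (I0 : V -> set 'M[R]_(n + n + 1)) (a b al be ga de : R).
Hypothesis homogeneous : infinitesimally_homogeneous Un1 un0 D P T0 R0 I0.
Hypothesis params : inner_torsion_parameters I0 a b al be ga de.

Let GP : is_Gstructure Un1 P := homogeneous.1.
Local Notation lam := (lambda_mx a b al be ga de).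

(** Both sides of the homogeneity condition on the inner torsion are cosets of
    u(n), and L represents the first one in the frame s. *)
Lemma Lambda_un0 x s u L : local_section P x s -> is_Lambda D s x u L ->
  un0 (L - lam u).
Proof.
move=> sP sL; have Ps := nbhs_singleton sP.1.
have [ls [g sg gs]] := Gs_frame GP Ps.
pose B (v : tangent_space x) : tangent_space x := s x (L *m g v).
have Bs w : B (s x w) = s x (L *m w) by rewrite /B sg.
have lB : linear B.
  move=> k v v'; rewrite /B -[v]gs -[v']gs -ls !sg.
  by rewrite mulmxDr -scalemxAr ls.
have : inner_torsion un0 D P (s x u) B.
  exists s, u, L; split=> //; split=> //; exists L => //.
  by rewrite /Defs.coset /= subrr; exact: un0_0.
rewrite (I0_inner_torsion homogeneous.2)// -[u]vsubmxK [dsubmx u]mx11_scalar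
  params.
case=> _ [A lamA AE]; have -> : L = A.
  apply/matrixP => i j.
  have /(congr1 (fun v : V => v i 0)) :
    L *m delta_mx j 0 = A *m delta_mx j 0 :> V.
    by apply: (frame_inj GP Ps); rewrite -Bs AE.
  by rewrite -!colE !mxE.
by rewrite -mx11_scalar vsubmxK.
Qed.

Lemma torsion_free : (forall u v, T0 u v = 0) -> forall x X Y,
  vfield_smooth_at x X -> vfield_smooth_at x Y -> torsion D X Y x = 0.
Proof.
move=> T00 x X Y Xx Yx; have [p Pp] := frame_nonempty GP x.
have [u Xu] := frame_surj GP (X x) Pp; have [v Yv] := frame_surj GP (Y x) Pp.
rewrite (T0_torsion homogeneous.2 Pp Xx Yx Xu Yv) T00.
exact: lin0 (frame_linear GP Pp).
Qed.

(** Frames of the structure are orthonormal, so that compatibility with the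
    metric says that the connection matrices are skew. *)
Lemma compatible_skew x s u L w w' : is_levi_civita D (gmetric P) ->
  local_section P x s -> is_Lambda D s x u L ->
    inner (L *m w) w' + inner w (L *m w') = 0.
Proof.
move=> [_ Dg] sP sL; have Ps := nbhs_singleton sP.1.
have := Dg x (s x u) _ _ (sP.2 w) (sP.2 w').
rewrite !sL !(gmetricE GP _ _ Ps) => <-.
rewrite -(@tv_local _ _ _ _ _ (cst (inner w w'))) ?tv_cst//.
  by apply: filterS sP.1 => y Py; rewrite (gmetricE GP _ _ Py).
exact: smooth_cst.
Qed.

(** The connection matrix and its part in u(n) are skew, hence so is lambda. *)
Lemma lambda_skew : is_levi_civita D (gmetric P) ->
  forall u w w', inner (lam u *m w) w' + inner w (lam u *m w') = 0.
Proof.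
move=> LC u w w'; have [x _] := manifold_nonempty M.
have [s sP] := Gs_section GP x.
have [L sL] := Lambda_exists D u (local_section_frame GP sP).
have [Ask _ _] := un0P (Lambda_un0 sP sL).
have := compatible_skew w w' LC sP sL.
rewrite -[L](subrK (lam u)); move: (L - lam u) Ask => A Ask.
by rewrite !mulmxDl innerDl innerDr (inner_mull A) Ask mulNmx innerNr => <-;
  ring.
Qed.

(** Skewness of lambda is tested on e, a horizontal vector h and Phi0 h, which
    are orthogonal. *)
Lemma levi_civita_params : (1 <= n)%N -> is_levi_civita D (gmetric P) ->
  [/\ a = 0, b = 0, ga = - al & de = - be].
Proof.
move=> n1 LC; have sk := lambda_skew LC.
have [h h0 eh] := horizontal_vector R n1.
have hh : 0 < inner h h := inner_gt0 h0.
have ePh : inner e (Phi *m h) = 0 := inner_e_Phi h.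
have hPh : inner h (Phi *m h) = 0.
  by rewrite innerC inner_skew// Phi0T.
have PhPh : inner (Phi *m h) (Phi *m h) = inner h h.
  by rewrite inner_Phi_Phi eh mulr0 subr0.
have Phe : inner (Phi *m h) e = 0 by rewrite innerC.
have he : inner h e = 0 by rewrite innerC.
have ee := @inner_ee R n.
have split0 (k : R) : k * inner h h = 0 -> k = 0.
  by move/eqP; rewrite mulf_eq0 (gt_eqF hh) orbF => /eqP.
have hPh' : inner (Phi *m h) h = 0 by rewrite innerC.
split.
- have := sk e h h; rewrite !lambda_mxE /xi_deriv !(Phi0_e, inner_bilin, ee, eh,
  he) => E.
  by apply: split0; lra.
- by have := sk e e e;
  rewrite !lambda_mxE /xi_deriv !(Phi0_e, inner_bilin, ee) => E; lra.
- have := sk h e h; rewrite !lambda_mxE /xi_deriv !(inner_bilin, ee, eh, he,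
  ePh, Phe, hPh, hPh') => E.
  by apply/eqP; rewrite -subr_eq0 opprK; apply/eqP; apply: split0; lra.
- have := sk h e (Phi *m h).
  rewrite !lambda_mxE /xi_deriv !(inner_bilin, ee, eh, he, ePh, Phe, hPh, hPh',
    PhPh) => E.
  by apply/eqP; rewrite -subr_eq0 opprK; apply/eqP; apply: split0; lra.
Qed.

End Connection.

(** * The trans-Sasakian structure of a metric connection *)

Section MetricConnection.
Context {R : realType} {n : nat} {M : manifold R (n + n + 1)}.
Local Notation V := 'cV[R]_(n + n + 1).
Local Notation e := (evec : V).
Local Notation Phi := (Phi0 : 'M[R]_(n + n + 1)).
Implicit Types (x y : M) (u v w : V).
Variables (D : connection M) (P : frames M).
Arguments P : clear implicits.
Variables (T0 : V -> V -> V) (R0 : V -> V -> 'M[R]_(n + n + 1))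
    (I0 : V -> set 'M[R]_(n + n + 1)) (al be : R).
Hypothesis homogeneous : infinitesimally_homogeneous Un1 un0 D P T0 R0 I0.
Hypothesis T00 : forall u v, T0 u v = 0.
Hypothesis params : inner_torsion_parameters I0 0 0 al be (- al) (- be).

Let GP : is_Gstructure Un1 P := homogeneous.1.
Local Notation zeta := (xi_deriv al be).

Lemma skew_lambda_mxE u w : lambda_mx 0 0 al be (- al) (- be) u *m w =
  inner e w *: zeta u - inner (zeta u) w *: e.
Proof.
rewrite lambda_mxE !mul0r scale0r add0r addr0; congr (_ + _).
by rewrite /xi_deriv !scaleNr -opprD innerNl scaleNr.
Qed.

Lemma inner_e_zeta u : inner e (zeta u) = 0.
Proof.
by rewrite /xi_deriv !inner_bilin inner_ee inner_e_Phi mulr1 subrr !mulr0 addr0.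
Qed.

Section OneLambda.
Variables (x : M) (s : forall y : M, V -> tangent_space y) (u : V).
Variable L : 'M[R]_(n + n + 1).
Hypotheses (sP : local_section P x s) (sL : is_Lambda D s x u L).

Lemma Lambda_split : exists A, [/\ A^T = - A, A *m Phi = Phi *m A, A *m e = 0 &
  forall w, L *m w = A *m w + (inner e w *: zeta u - inner (zeta u) w *: e)].
Proof.
have [Ask AP Ae] := un0P (Lambda_un0 homogeneous params sP sL).
exists (L - lambda_mx 0 0 al be (- al) (- be) u); split=> // w.
by rewrite mulmxBl skew_lambda_mxE subrK.
Qed.

Lemma Lambda_skew w w' : inner (L *m w) w' + inner w (L *m w') = 0.
Proof.
have [A [Ask _ _ LE]] := Lambda_split.
rewrite !LE; move: (zeta u) => z;
  rewrite !inner_bilin (inner_mull A) Ask mulNmx innerNr.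
by rewrite (innerC w e) (innerC w z); ring.
Qed.

Lemma Lambda_e : L *m e = zeta u.
Proof.
have [A [_ _ Ae ->]] := Lambda_split.
by rewrite Ae inner_ee innerC inner_e_zeta scale0r subr0 scale1r add0r.
Qed.

Lemma inner_e_Lambda w : inner e (L *m w) = - inner (zeta u) w.
Proof.
by have /eqP := Lambda_skew e w; rewrite Lambda_e addrC addr_eq0 => /eqP.
Qed.

(** The unitary part of the connection matrix commutes with Phi; only the
    inner torsion contributes to the commutator. *)
Lemma Lambda_Phi w : L *m (Phi *m w) - Phi *m (L *m w) =
  - (inner (zeta u) (Phi *m w) *: e) - inner e w *: (Phi *m zeta u).
Proof.
have [A [_ AP _ LE]] := Lambda_split.
rewrite !LE inner_e_Phi scale0r sub0r; move: (zeta u) => z;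
  rewrite !mulmxDr !mulmxA AP mulmxN -!scalemxAr Phi0_e.
by rewrite scaler0 subr0 opprD addrACA subrr add0r.
Qed.

End OneLambda.

(** For fields with components Y and Z the derivative of <Y, Z> differs from
    the metric expression by <L Y, Z> + <Y, L Z>, which vanishes. *)
Lemma metric_is_levi_civita : is_levi_civita D (gmetric P).
Proof.
split; first exact: (torsion_free homogeneous T00).
move=> x v Y Z Yx Zx; have [s sP] := Gs_section GP x.
have Ps := nbhs_singleton sP.1; have sf := local_section_frame GP sP.
have [u ->] := frame_surj GP v Ps; have [L sL] := Lambda_exists D u sf.
have [Yc sY YE] := smooth_components sf Yx.
have [Zc sZ ZE] := smooth_components sf Zx.
rewrite (nabla_frame sf sL sY YE) (nabla_frame sf sL sZ ZE).
rewrite (nbhs_singleton YE) (nbhs_singleton ZE) !(gmetricE GP _ _ Ps).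
rewrite -(@tv_local _ _ _ _ _ (fun y => inner (Yc y) (Zc y))); first last.
- exact: smooth_inner.
- by apply: filterS3 sP.1 YE ZE => y Py -> ->; rewrite (gmetricE GP _ _ Py).
rewrite tv_inner// innerDl innerDr addrACA.
by rewrite (Lambda_skew sP sL) addr0.
Qed.

Lemma nabla_xi x (v : tangent_space x) : Hdist P v ->
  D x v (xi P) = al *: v + be *: phi P v.
Proof.
have [s sP] := Gs_section GP x.
have Ps := nbhs_singleton sP.1; have sf := local_section_frame GP sP.
have [ls _] := Gs_frame GP Ps.
have [u ->] := frame_surj GP v Ps; have [L sL] := Lambda_exists D u sf => vH.
have eu := HdistE GP Ps vH.
rewrite -(@nabla_local _ _ _ _ _ _ (fun y => s y e)); first last.
- by apply: filterS sP.1 => y Py; rewrite (xiE GP Py).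
- exact: sP.2.
rewrite sL (Lambda_e sP sL) /xi_deriv eu scale0r subr0.
by rewrite (linD ls) !(linZ ls) (phiE GP _ Ps).
Qed.

(** In a frame phi is the constant Phi0, so its covariant derivative is the
    commutator of the connection matrix with Phi0. *)
Lemma metric_trans_sasakian :
  trans_sasakian (phi P) (xi P) (eta P) (gmetric P) (- be) al.
Proof.
split; first exact: structure_almost_contact.
exists D; first exact: metric_is_levi_civita.
move=> x v Y Yx; have [s sP] := Gs_section GP x.
have Ps := nbhs_singleton sP.1; have sf := local_section_frame GP sP.
have [ls _] := Gs_frame GP Ps.
have [u ->] := frame_surj GP v Ps; have [L sL] := Lambda_exists D u sf.
have [Yc sY YE] := smooth_components sf Yx.
have PYE : \forall y \near x, phi P (Y y) = s y (Phi *m Yc y).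
  by apply: filterS2 sP.1 YE => y Py ->; rewrite (phiE GP _ Py).
have sPY := smooth_mulmx Phi sY.
rewrite (nabla_frame sf sL sPY PYE) (nabla_frame sf sL sY YE).
rewrite (nbhs_singleton YE) !(gmetricE GP _ _ Ps, etaE GP _ Ps, xiE GP Ps,
  phiE GP _ Ps).
rewrite tv_mulmx// -!(linZ ls) -!(linB ls) -!(linZ ls) -(linD ls)
  -!(gmetricE GP _ _ Ps).
congr (s x _); rewrite !(gmetricE GP _ _ Ps) mulmxDr opprD addrACA subrr add0r
  (Lambda_Phi sP sL).
move: (Yc x) => w; rewrite /xi_deriv mulmxDr -!scalemxAr Phi0_Phi0 mulmxBr
  -scalemxAr Phi0_e.
rewrite !inner_bilin inner_Phi_Phi inner_e_Phi.
rewrite inner_Phil !scaler0 !subr0.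
apply/colP => i; rewrite !mxE; ring.
Qed.

(** This is the vanishing of the torsion on two frame fields. *)
Lemma bracket_frame x s u v Lu Lv : local_section P x s ->
  is_Lambda D s x u Lu -> is_Lambda D s x v Lv ->
  bracket (fun y => s y u) (fun y => s y v) x = s x (Lu *m v - Lv *m u).
Proof.
move=> sP sLu sLv; have ls := frame_linear GP (nbhs_singleton sP.1).
have := torsion_free homogeneous T00 (sP.2 u) (sP.2 v).
by rewrite /torsion sLu sLv -(linB ls) => /eqP; rewrite subr_eq0 => /eqP.
Qed.

(** Only the inner torsion contributes to this component, so it does not depend
    on the point. *)
Lemma inner_e_bracket x s u v Lu Lv : local_section P x s ->
  is_Lambda D s x u Lu -> is_Lambda D s x v Lv ->
  inner e (Lu *m v - Lv *m u) = - (2 * be) * inner (Phi *m u) v.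
Proof.
move=> sP sLu sLv; rewrite innerDr innerNr (inner_e_Lambda sP sLu)
  (inner_e_Lambda sP sLv).
rewrite /xi_deriv !inner_bilin [inner (Phi *m v) u]inner_Phil
  [inner v (Phi *m u)]innerC.
by rewrite (innerC v u); ring.
Qed.

(** The eta-component of the bracket of two frame fields is constant, so that
    a second bracket only sees it through the connection. *)
Lemma eta_double_bracket x s u v w Lu Lv : local_section P x s ->
  is_Lambda D s x u Lu -> is_Lambda D s x v Lv ->
  eta P (bracket (bracket (fun y => s y u) (fun y => s y v))
                 (fun y => s y w) x) =
  - (2 * be) * inner (Phi *m (Lu *m v - Lv *m u)) w.
Proof.
move=> sP sLu sLv; have Ps := nbhs_singleton sP.1;
  have ls := frame_linear GP Ps.
have sf := local_section_frame GP sP.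
set B := bracket (fun y => s y u) _.
have Bx : vfield_smooth_at x B := bracket_smooth (sP.2 u) (sP.2 v).
have [Bc sB BE] := smooth_components sf Bx.
have Bcx : Bc x = Lu *m v - Lv *m u.
  apply: (frame_inj GP Ps); rewrite -(nbhs_singleton BE).
  exact: bracket_frame.
have eB : \forall y \near x, inner e (Bc y) = - (2 * be) * inner (Phi *m u) v.
  near=> y; have sPy : local_section P y s by near: y;
    exact: (local_section_near GP sP).
  have sfy := local_section_frame GP sPy.
  have [Mu sMu] := Lambda_exists D u sfy;
    have [Mv sMv] := Lambda_exists D v sfy.
  rewrite -(inner_e_bracket sPy sMu sMv); congr (inner e _).
  apply: (frame_inj GP (nbhs_singleton sPy.1)).
  rewrite -(bracket_frame sPy sMu sMv).
  by apply/esym; near: y.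
have [Lw sLw] := Lambda_exists D w sf.
have [LB sLB] := Lambda_exists D (Bc x) sf.
have := torsion_free homogeneous T00 Bx (sP.2 w).
rewrite /torsion (nabla_frame sf sLw sB BE) (nbhs_singleton BE) sLB -(linB ls).
move=> /eqP; rewrite subr_eq0 => /eqP <-; rewrite (etaE GP _ Ps).
rewrite opprD addrCA innerDr innerNr (inner_e_bracket sP sLB sLw) -Bcx.
suff -> : inner e (\col_i s x w (fun y => Bc y i 0)) = 0 by rewrite oppr0 add0r.
have se i : smooth_at x (fun y : M => e i 0) by exact: smooth_cst.
have := tv_inner (s x w) se sB.
rewrite -(tv_local (f := cst (- (2 * be) * inner (Phi *m u) v))) ?tv_cst;
  first last.
- exact: smooth_cst.
- by apply: filterS eB => y ->.
rewrite (_ : \col_i s x w (fun=> e i 0) = 0) ?inner0l ?add0r//.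
by apply/colP => i; rewrite !mxE; exact: tv_cst.
Unshelve. all: by end_near. Qed.

(** The eta-component of the Jacobi identity for the frame fields attached to
    e, h and J h with h in H0; this is the vanishing of d (d eta) on them. *)
Lemma product_zero : (1 <= n)%N -> (- be) * al = 0.
Proof.
move=> n1; have [x _] := manifold_nonempty M; have [s sP] := Gs_section GP x.
have Ps := nbhs_singleton sP.1; have sf := local_section_frame GP sP.
have [h h0 eh] := horizontal_vector R n1.
have hh : 0 < inner h h := inner_gt0 h0.
have [Le sLe] := Lambda_exists D e sf; have [Lh sLh] := Lambda_exists D h sf.
have [Lk sLk] := Lambda_exists D (Phi *m h) sf.
have := jacobi (sP.2 e) (sP.2 h) (sP.2 (Phi *m h)).
move=> /(congr1 (eta P (x := x))).
have le : linear (eta P (x := x) : tangent_space x -> R^o).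
  exact: acm_eta_linear (structure_almost_contact GP) x.
have etaD (p q : tangent_space x) : eta P (p + q) = eta P p + eta P q.
  by have := le 1 p q; rewrite !scale1r.
have eta0 : eta P (0 : tangent_space x) = 0.
  by have := etaD 0 0; rewrite addr0 => /eqP;
    rewrite -subr_eq0 opprD addNKr oppr_eq0 => /eqP.
rewrite !etaD eta0 (eta_double_bracket _ sP sLe sLh)
  (eta_double_bracket _ sP sLh sLk)
  (eta_double_bracket _ sP sLk sLe).
have skew w : inner (Le *m w) w = 0.
  have := Lambda_skew sP sLe w w; rewrite (innerC w) => E; lra.
rewrite (Lambda_e sP sLh) (Lambda_e sP sLk).
rewrite [inner (Phi *m _) e]innerC inner_e_Phi mulr0 addr0.
rewrite inner_Phi_Phi eh mulr0 subr0 inner_Phil.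
have inner_zeta w : inner e w = 0 -> inner (zeta w) w = al * inner w w.
  move=> ew; rewrite /xi_deriv ew scale0r subr0 innerDl !innerZl.
  by rewrite inner_skew ?Phi0T// mulr0 addr0.
rewrite (innerDl (Le *m h)) innerNl skew (inner_zeta _ eh).
rewrite (innerDl (zeta _)) innerNl skew (inner_zeta _ (inner_e_Phi h)).
rewrite inner_Phi_Phi eh mulr0 subr0 => E.
have /eqP : (- be * al) * inner h h = 0 by lra.
by rewrite mulf_eq0 (gt_eqF hh) orbF => /eqP.
Qed.

End MetricConnection.

(** * The characterization of the Levi-Civita connection *)

Theorem proposition4p21 (R : realType) (n : nat) (n_ge1 : (1 <= n)%N)
    (M : manifold R (n + n + 1)) (nabla : connection M) (P : frames M)
    (T0 : 'cV[R]_(n + n + 1) -> 'cV[R]_(n + n + 1) -> 'cV[R]_(n + n + 1))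
    (R0 : 'cV[R]_(n + n + 1) -> 'cV[R]_(n + n + 1) -> 'M[R]_(n + n + 1))
    (I0 : 'cV[R]_(n + n + 1) -> set 'M[R]_(n + n + 1))
    (a b alpha beta gamma delta : R)
    (homogeneous : infinitesimally_homogeneous Un1 un0 nabla P T0 R0 I0)
    (T0_eq0 : forall u v, T0 u v = 0)
    (params : inner_torsion_parameters I0 a b alpha beta gamma delta) :
  (is_levi_civita nabla (gmetric P) <->
    [/\ a = 0, b = 0, gamma = - alpha & delta = - beta]) /\
  (is_levi_civita nabla (gmetric P) ->
    [/\ forall (x : M) (v : tangent_space x), Hdist P v ->
          nabla x v (xi P) = alpha *: v + beta *: phi P v,
        trans_sasakian (phi P) (xi P) (eta P) (gmetric P) (- beta) alpha &
        (- beta) * alpha = 0]).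
Proof.
have params0 : [/\ a = 0, b = 0, gamma = - alpha & delta = - beta] ->
    inner_torsion_parameters I0 0 0 alpha beta (- alpha) (- beta).
  by case=> a0 b0 g0 d0; move: params; rewrite a0 b0 g0 d0.
split; first split.
- exact: levi_civita_params homogeneous params n_ge1.
- by move=> /params0; exact: metric_is_levi_civita homogeneous T0_eq0.
- move=> /(levi_civita_params homogeneous params n_ge1)/params0 par; split.
  + exact: nabla_xi homogeneous par.
  + exact: metric_trans_sasakian homogeneous T0_eq0 par.
  + exact: product_zero homogeneous T0_eq0 par n_ge1.
Qed.
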